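(* Let $3 \leq n \leq 8$ and let $f \in \mathrm{Mod}^+(M_n)$ be an irreducible mapping class of odd, prime order. Then $f$ is conjugate in $\mathrm{Mod}^+(M_n)$ to a power of a Coxeter element of $W_n \leq \mathrm{Mod}^+(M_n)$.
   Context: For $0\le n\le 8$ let $M_n = \mathbb{CP}^2 \# n\overline{\mathbb{CP}^2}$, a closed oriented smooth 4-manifold. $H_2(M_n,\mathbb{Z})$ has standard basis $H,E_1,\dots,E_n$, orthogonal for the intersection form $Q_{M_n}$, with $Q_{M_n}(H,H)=1$, $Q_{M_n}(E_i,E_i)=-1$. $\mathrm{Mod}(M_n)=\pi_0(\mathrm{Homeo}^+(M_n))$; its action on $H_2$ is an isomorphism onto $\mathrm{Aut}(H_2(M_n,\mathbb{Z}),Q_{M_n})\cong \mathrm{O}(1,n)(\mathbb{Z})$, and the two groups are identified. $\mathrm{Mod}^+(M_n)$ is the index-2 subgroup preserving each sheet of the hyperboloid $\{v\in H_2(M_n,\mathbb{R}):Q_{M_n}(v,v)=1\}$. Irreducibility: a del Pezzo manifold is one of $\mathbb{CP}^2$, $\mathbb{CP}^1\times\mathbb{CP}^1$, or $M_k$ with $1\le k\le 8$. A class $f\in\mathrm{Mod}(M_n)$ is reducible if there exist a del Pezzo manifold $M$, an integer $k>0$ and an isometry $\iota:(H_2(M,\mathbb{Z})\oplus H_2(\#k\overline{\mathbb{CP}^2},\mathbb{Z}),Q_M\oplus Q_{\#k\overline{\mathbb{CP}^2}})\to(H_2(M_n,\mathbb{Z}),Q_{M_n})$ such that $f$ lies in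 the image of the induced inclusion $\mathrm{Mod}(M)\times\mathrm{Mod}(\#k\overline{\mathbb{CP}^2})\hookrightarrow\mathrm{Mod}(M_n)$ (mapping class groups being identified with isometry groups of $H_2$). Otherwise $f$ is irreducible. Weyl group: $W_n\le\mathrm{Mod}(M_n)$ is the stabilizer of $K_{M_n}=-3H+\sum_{k=1}^nE_k$. For $v$ with $Q_{M_n}(v,v)\in\{\pm1,\pm2\}$, $\mathrm{Ref}_v(x)=x-\frac{2Q_{M_n}(x,v)}{Q_{M_n}(v,v)}v$. For $3\le n\le 8$, $W_n$ is a finite Coxeter group generated by the simple reflections $\mathrm{Ref}_{H-E_1-E_2-E_3},\mathrm{Ref}_{E_1-E_2},\dots,\mathrm{Ref}_{E_{n-1}-E_n}$, and is contained in $\mathrm{Mod}^+(M_n)$. A Coxeter element of $W_n$ is a product of the simple reflections, each taken once, in any order. *)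

(* Defs.v *)
From mathcomp Require Import all_boot all_order all_algebra.
From mathcomp Require Import reals.

Set Implicit Arguments.
Unset Strict Implicit.
Unset Printing Implicit Defensive.

Import Order.TTheory GRing.Theory Num.Theory.
Local Open Scope ring_scope.

(** A lattice is a Gram matrix [G : 'M[int]_r], standing for the bilinear form
    x, y |-> x^T G y on the column vectors Z^r; homomorphisms are integer
    matrices acting on columns from the left. *)

Definition form (R : comNzRingType) (r : nat) (G : 'M[R]_r) (x y : 'cV[R]_r) : R :=
  (x^T *m G *m y) ord0 ord0.

(** Isometries are isomorphisms of lattices, hence bijective. *)
Definition isometry (r s : nat) (G : 'M[int]_r) (G' : 'M[int]_s)
    (P : 'M[int]_(s, r)) : Prop :=
  bijective (fun x : 'cV[int]_r => P *m x) /\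
  forall x y : 'cV[int]_r, form G' (P *m x) (P *m y) = form G x y.

(** The mapping class group of a manifold with intersection form [G],
    identified with the isometry group of its H_2. *)
Definition Mod (r : nat) (G : 'M[int]_r) (A : 'M[int]_r) : Prop := isometry G G A.

(** Intersection form of M_n = CP^2 # n(-CP^2) in the basis H, E_1, ..., E_n:
    index 0 is H and index i > 0 is E_i. *)
Definition QM (n : nat) : 'M[int]_n.+1 :=
  diag_mx (\row_(j < n.+1) (if j == ord0 then 1 else -1)).

(** Intersection form of #k(-CP^2). *)
Definition Qneg (k : nat) : 'M[int]_k := - 1%:M.

Inductive delPezzo : Type :=
| CP2
| CP1xCP1
| Mk (k : nat) of (0 < k <= 8)%N.

Definition b2 (M : delPezzo) : nat :=
  match M with CP2 => 1 | CP1xCP1 => 2 | Mk k _ => k.+1 end.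

Definition QdP (M : delPezzo) : 'M[int]_(b2 M) :=
  match M return 'M[int]_(b2 M) with
  | CP2 => 1%:M
  | CP1xCP1 => \matrix_(i < 2, j < 2) (i != j)%:R
  | Mk k _ => QM k
  end.

Definition reducible (n : nat) (f : 'M[int]_n.+1) : Prop :=
  exists (M : delPezzo) (k : nat) (P : 'M[int]_(n.+1, b2 M + k)),
    [/\ (0 < k)%N,
        isometry (block_mx (QdP M) 0 0 (Qneg k)) (QM n) P &
        exists (g : 'M[int]_(b2 M)) (h : 'M[int]_k),
          [/\ Mod (QdP M) g, Mod (Qneg k) h &
              f *m P = P *m block_mx g 0 0 h]].

Definition irreducible (n : nat) (f : 'M[int]_n.+1) : Prop := ~ reducible f.

(** The two sheets of the hyperboloid Q(v, v) = 1 in H_2(M_n, R) are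
    distinguished by the sign of the H-coordinate, which never vanishes there. *)
Definition hyperboloid (R : realType) (n : nat) (v : 'cV[R]_n.+1) : Prop :=
  form (map_mx intr (QM n)) v v = 1.

Definition upper_sheet (R : realType) (n : nat) (v : 'cV[R]_n.+1) : Prop :=
  hyperboloid v /\ 0 < v ord0 ord0.

Definition lower_sheet (R : realType) (n : nat) (v : 'cV[R]_n.+1) : Prop :=
  hyperboloid v /\ v ord0 ord0 < 0.

Definition ModPlus (R : realType) (n : nat) (f : 'M[int]_n.+1) : Prop :=
  [/\ Mod (QM n) f,
      forall v : 'cV[R]_n.+1, upper_sheet (map_mx intr f *m v) <-> upper_sheet v &
      forall v : 'cV[R]_n.+1, lower_sheet (map_mx intr f *m v) <-> lower_sheet v].

Definition has_order (n : nat) (f : 'M[int]_n.+1) (p : nat) : Prop :=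
  [/\ (0 < p)%N, f ^+ p = 1 &
      forall m : nat, (0 < m < p)%N -> f ^+ m <> 1].

Definition Hcl (n : nat) : 'cV[int]_n.+1 := delta_mx ord0 ord0.

(** Meaningful for 1 <= i <= n only. *)
Definition Ecl (n i : nat) : 'cV[int]_n.+1 := delta_mx (inord i) ord0.

Definition Kcl (n : nat) : 'cV[int]_n.+1 :=
  - (Hcl n *+ 3) + \sum_(1 <= i < n.+1) Ecl n i.

Definition weyl (n : nat) (f : 'M[int]_n.+1) : Prop :=
  Mod (QM n) f /\ f *m Kcl n = Kcl n.

(** The matrix of x |-> x - (2 Q(x, v) / Q(v, v)) v, for Q(v, v) = ±1, ±2;
    the integer quotient 2 %/ Q(v, v) is then exact (see [reflE]). *)
Definition refl (n : nat) (v : 'cV[int]_n.+1) : 'M[int]_n.+1 :=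
  1%:M - (2 %/ form (QM n) v v)%Z *: (v *m v^T *m QM n).

Definition simple_roots (n : nat) : seq 'cV[int]_n.+1 :=
  (Hcl n - Ecl n 1 - Ecl n 2 - Ecl n 3)
    :: [seq Ecl n i - Ecl n i.+1 | i <- iota 1 n.-1].

Definition coxeter_element (n : nat) (c : 'M[int]_n.+1) : Prop :=
  exists2 s : seq 'cV[int]_n.+1,
    perm_eq s (simple_roots n) & c = \prod_(v <- s) refl v.

Lemma QM_sym n : (QM n)^T = QM n.
Proof. by rewrite /QM tr_diag_mx. Qed.

Lemma form_sym n (x y : 'cV[int]_n.+1) : form (QM n) x y = form (QM n) y x.
Proof.
rewrite /form -[in LHS](trmxK (x^T *m QM n *m y)) [in LHS]mxE.
by rewrite !trmx_mul trmxK QM_sym mulmxA.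
Qed.

Lemma refl_mul n (v x : 'cV[int]_n.+1) :
  refl v *m x = x - ((2 %/ form (QM n) v v)%Z * form (QM n) x v) *: v.
Proof.
rewrite /refl mulmxBl mul1mx -scalemxAl -scalerA; congr (_ - _ *: _).
rewrite -!mulmxA (mulmxA v^T) (mx11_scalar (v^T *m _ *m _)) mul_mx_scalar.
by rewrite form_sym.
Qed.

Lemma reflE n (v x : 'cV[int]_n.+1) :
  form (QM n) v v \in [:: 1; -1; 2; -2] ->
  refl v *m x
    = x - ((2 * form (QM n) x v) %/ form (QM n) v v)%Z *: v.
Proof.
rewrite refl_mul !inE => qv; congr (_ - _ *: _).
have d2 : (form (QM n) v v %| 2)%Z by case/or4P: qv => /eqP ->.
by rewrite mulrC -divz_mulAC // mulrC. 
Qed.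

Lemma formBr n (x y z : 'cV[int]_n.+1) :
  form (QM n) x (y - z) = form (QM n) x y - form (QM n) x z.
Proof. by rewrite /form mulmxBr !mxE. Qed.

Lemma form_delta n (x : 'cV[int]_n.+1) (j : 'I_n.+1) :
  form (QM n) x (delta_mx j ord0) = (if j == ord0 then 1 else -1) * x j ord0.
Proof.
rewrite /form /QM mul_mx_diag mxE (bigD1 j) //= !mxE !eqxx mulr1 big1 ?addr0 //.
  by rewrite mulrC.
by move=> i /negbTE ij; rewrite !mxE ij /= mulr0.
Qed.

Lemma form_Hcl n (x : 'cV[int]_n.+1) : form (QM n) x (Hcl n) = x ord0 ord0.
Proof. by rewrite form_delta eqxx mul1r. Qed.

Lemma form_Ecl n i (x : 'cV[int]_n.+1) : (0 < i <= n)%N ->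
  form (QM n) x (Ecl n i) = - x (inord i) ord0.
Proof.
move=> /andP[i0 ile]; rewrite form_delta -val_eqE /= inordK //.
by rewrite -[i == 0%N]negbK -lt0n i0 /= mulN1r.
Qed.

Lemma HclE n i : (i <= n)%N -> Hcl n (inord i) ord0 = (i == 0%N)%:R.
Proof. by move=> ile; rewrite mxE eqxx andbT -val_eqE /= inordK. Qed.

Lemma EclE n i j : (i <= n)%N -> (j <= n)%N ->
  Ecl n j (inord i) ord0 = (i == j)%:R.
Proof. by move=> ile jle; rewrite mxE eqxx andbT -val_eqE /= !inordK. Qed.

Lemma inord00 n : inord 0 = ord0 :> 'I_n.+1.
Proof. by apply/val_inj; rewrite /= inordK. Qed.

Lemma KclE n i : (i <= n)%N ->
  Kcl n (inord i) ord0 = if i == 0%N then -3 else 1.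
Proof.
move=> ile; rewrite /Kcl mxE summxE big_nat_cond.
rewrite (eq_bigr (fun j => (i == j)%:R)); last first.
  by move=> j; rewrite andbT ltnS => /andP[_ jle]; rewrite EclE.
rewrite -big_nat_cond mxE mulmxnE HclE //; case: i ile => [|i] ile /=.
  by rewrite big_nat_cond big1 ?addr0 // => -[|j].
rewrite mul0rn oppr0 add0r (bigD1_seq i.+1) ?iota_uniq ?mem_index_iota //=.
by rewrite eqxx big1 ?addr0 // => j /negbTE; rewrite eq_sym => ->.
Qed.

Lemma subcE n (x y : 'cV[int]_n.+1) i : (x - y) i ord0 = x i ord0 - y i ord0.
Proof. by rewrite !mxE. Qed.

Lemma simple_rootP n v : (3 <= n)%N -> v \in simple_roots n ->
  form (QM n) v v = -2 /\ form (QM n) (Kcl n) v = 0.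
Proof.
move=> n3; have n2 := ltnW n3; have n1 := ltnW n2.
rewrite inE => /orP[/eqP -> | /mapP[i]].
  have v0 (x : 'cV[int]_n.+1) : x ord0 ord0 = x (inord 0) ord0.
    by rewrite inord00.
  rewrite !formBr !form_Hcl !form_Ecl // !(v0 (_ - _)) (v0 (Kcl n)).
  by rewrite !subcE !KclE // !HclE // !EclE.
rewrite mem_iota => /andP[i0 ile] ->.
have {}ile : (i < n)%N by rewrite add1n prednK in ile.
have ile' := ltnW ile.
rewrite !formBr !form_Ecl ?i0 ?ile' // !KclE //.
rewrite !subcE !EclE // !eqxx (gtn_eqF (ltnSn i)) (ltn_eqF (ltnSn i)).
by rewrite -[i == 0%N]negbK -lt0n i0.
Qed.

Lemma refl_weyl n v : (3 <= n)%N -> v \in simple_roots n -> weyl (refl v).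
Proof.
move=> n3 /(simple_rootP n3)[vv Kv].
have rE x : refl v *m x = x + form (QM n) x v *: v.
  by rewrite refl_mul vv mulN1r scaleNr opprK.
have formDr x y z : form (QM n) x (y + z) = form (QM n) x y + form (QM n) x z.
  by rewrite /form mulmxDr !mxE.
have formZr a x y : form (QM n) x (a *: y) = a * form (QM n) x y.
  by rewrite /form -scalemxAr !mxE.
have formr x y : form (QM n) x (refl v *m y)
    = form (QM n) x y + form (QM n) y v * form (QM n) x v.
  by rewrite rE formDr formZr.
have rv x : form (QM n) (refl v *m x) v = - form (QM n) x v.
  rewrite form_sym formr vv [form _ v x]form_sym mulrN mulr_natr mulr2n opprD.
  by rewrite addrA subrr sub0r.
split; last by rewrite rE Kv scale0r addr0.
split=> [|x y]; last first.
  rewrite formr rv form_sym formr [form _ y x]form_sym mulrN.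
  by rewrite [form _ y v * _]mulrC addrK.
by exists (fun x => refl v *m x) => x; rewrite rE rv rE scaleNr addrK.
Qed.

Lemma coxeter_weyl n (c : 'M[int]_n.+1) :
  (3 <= n)%N -> coxeter_element c -> weyl c.
Proof.
move=> n3 [s /perm_mem ps ->].
have {ps}: {subset s <= simple_roots n} by move=> v; rewrite ps.
elim: s => [|v s IHs] sub.
  rewrite big_nil; split; last by rewrite mul1mx.
  by split=> [|x y]; [exists id => x; rewrite mul1mx | rewrite !mul1mx].
have [[bv fv] Kv] := refl_weyl n3 (sub v (mem_head _ _)).
have [|[bs fs] Ks] := IHs; first by move=> u us; apply/sub/mem_behead.
rewrite big_cons; split; last by rewrite -mulmxA Ks Kv.
split=> [|x y]; last by rewrite -!mulmxA fv fs.
by apply: (eq_bij (bij_comp bv bs)) => x /=; rewrite mulmxA.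
Qed.

(* Main.v *)
(** The vector [v = H + f H + ... + f^(p-1) H] is fixed by [f], and after conjugation it lies
    in the Vinberg chamber [m_1 >= ... >= m_n >= 0], [d >= m_1 + m_2 + m_3].  If some [m_i]
    vanishes, then [f] permutes up to sign the (-1)-classes orthogonal to [v] and is
    reducible.  Otherwise [- K] is the unique characteristic vector of square [9 - n]
    minimizing the product with [v], so [f K = K].  A vector of [K^perp] fixed by an
    irreducible [f] vanishes: pushing it along [- K] to the wall [m_n = 0] would give a fixed
    nef class, either of positive square or a conic class, and [f] would be reducible.
    Hence [(9 - n) (x + f x + ... + f^(p-1) x) = p (x . K) K] for all [x].  This forces
    [(n, p) = (4, 5)], [(6, 3)], or [n = 8]; in the last case counting the fixed points of
    [f] modulo 2 and 3 leaves [p = 3, 5].  The identity also restricts the products of the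
    orbits of [E_1, ..., E_n] so much that a few of these orbits, chosen by a Ramsey argument
    for tournaments, have the same Gram matrix as explicit orbits of a power of a Coxeter
    element, and together with [K] they generate the lattice. *)
Require Import Defs.
From mathcomp Require Import all_boot all_order all_algebra all_fingroup all_solvable.
From mathcomp Require Import reals.
From mathcomp Require Import zify ring lra.

Import Order.TTheory GRing.Theory Num.Theory.
Local Open Scope ring_scope.
Set Implicit Arguments.
Unset Strict Implicit.
Unset Printing Implicit Defensive.

(** * Isometries and the hyperboloid *)

(** The proof does not go through a classification of the conjugacy classes of W_n. An isometry
    fixing K is recognised by the products between the vectors of a few orbits: if K and the
    corresponding orbits of a model generate the lattice, equal products give a conjugating
    isometry, and this isometry fixes K, hence lies in Mod^+. The difficulty is to pin down enough
    products. For p = 3 the sum of E_i . f E_j and E_j . f E_i is prescribed, so the larger product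
    orients the pair; this is the source of the tournaments. For p = 5 the products depend on the
    generator chosen in the group of [f], and one may pass to f^2 because f = (f^2)^3; for n = 8 the
    roots E_i + K then replace the E_i.

    The list of pairs (n, p) comes from the coefficient of E_1 in the identity for x = E_1: it shows
    that 9 - n divides p, which says nothing when n = 8. The oddness of p prevents an exchange of
    the two components of a conic fibre and excludes 9 - n = 2. *)

Notation dot := (Defs.form (QM _)).

Section Form.
Variables (n : nat).
Implicit Types (x y z : 'cV[int]_n.+1) (A f : 'M[int]_n.+1).

Lemma dotC x y : dot x y = dot y x. Proof. exact: form_sym. Qed.
Lemma dotDr x y z : dot x (y + z) = dot x y + dot x z.
Proof. by rewrite /Defs.form mulmxDr mxE. Qed.
Lemma dotDl x y z : dot (x + y) z = dot x z + dot y z.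
Proof. by rewrite dotC dotDr !(dotC z). Qed.
Lemma dotZr a x y : dot x (a *: y) = a * dot x y.
Proof. by rewrite /Defs.form -scalemxAr mxE. Qed.
Lemma dotZl a x y : dot (a *: x) y = a * dot x y.
Proof. by rewrite dotC dotZr dotC. Qed.
Lemma dotNr x y : dot x (- y) = - dot x y.
Proof. by rewrite -scaleN1r dotZr mulN1r. Qed.
Lemma dotNl x y : dot (- x) y = - dot x y.
Proof. by rewrite dotC dotNr dotC. Qed.
Lemma dotBr x y z : dot x (y - z) = dot x y - dot x z.
Proof. by rewrite dotDr dotNr. Qed.
Lemma dotBl x y z : dot (x - y) z = dot x z - dot y z.
Proof. by rewrite dotDl dotNl. Qed.
Lemma dot0r x : dot x 0 = 0.
Proof. by rewrite -(scale0r 0) dotZr mul0r. Qed.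
Lemma dot0l x : dot 0 x = 0. Proof. by rewrite dotC dot0r. Qed.
Lemma dot_sumr I (r : seq I) P x (F : I -> 'cV[int]_n.+1) :
  dot x (\sum_(i <- r | P i) F i) = \sum_(i <- r | P i) dot x (F i).
Proof. by elim/big_rec2: _ => [|i a b _ <-]; rewrite ?dot0r ?dotDr. Qed.
Lemma dot_suml I (r : seq I) P x (F : I -> 'cV[int]_n.+1) :
  dot (\sum_(i <- r | P i) F i) x = \sum_(i <- r | P i) dot (F i) x.
Proof. by rewrite dotC dot_sumr; apply: eq_bigr => i _; rewrite dotC. Qed.

Definition dotE := (dotDl, dotDr, dotBl, dotBr, dotNl, dotNr, dotZl, dotZr).

Lemma QM2 : QM n *m QM n = 1%:M.
Proof.
rewrite /QM mulmx_diag -diag_const_mx; congr diag_mx; apply/rowP => j.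
by rewrite !mxE; case: ifP; rewrite ?mulr1 ?mulN1r ?opprK.
Qed.

Definition isomQ f := f^T *m QM n *m f = QM n.

Lemma isomP f : isomQ f <-> forall x y, dot (f *m x) (f *m y) = dot x y.
Proof.
split=> [h x y|h].
  by rewrite /Defs.form trmx_mul -[in RHS]h !mulmxA.
pose d i : 'cV[int]_n.+1 := delta_mx i ord0.
apply/matrixP => i j; have := h (d i) (d j).
have -> : dot (f *m d i) (f *m d j)
    = ((d i)^T *m (f^T *m QM n *m f) *m d j) ord0 ord0.
  by rewrite /Defs.form trmx_mul !mulmxA.
have e M : ((d i)^T *m M *m d j) ord0 ord0 = M i j.
  by rewrite trmx_delta -(rowE i M) -(colE j) !mxE.
by rewrite /Defs.form !e.
Qed.

Lemma isom_dot f x y : isomQ f -> dot (f *m x) (f *m y) = dot x y.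
Proof. by move=> /isomP. Qed.

(** Q is its own inverse, so f^T Q f = Q makes this the inverse of an isometry [f]. *)
Definition adj f := QM n *m f^T *m QM n.

Lemma adjl f : isomQ f -> adj f *m f = 1%:M.
Proof. by move=> h; rewrite /adj -!mulmxA (mulmxA f^T) h QM2. Qed.
Lemma adjr f : isomQ f -> f *m adj f = 1%:M.
Proof. by move/adjl/mulmx1C. Qed.
Lemma isom_unit f : isomQ f -> f \is a GRing.unit.
Proof. by move=> h; apply/unitrP; exists (adj f); rewrite -!mulmxE adjl // adjr. Qed.
Lemma isom_adj f : isomQ f -> isomQ (adj f).
Proof.
move=> h; apply/isomP => x y; rewrite -(isom_dot _ _ h).
by rewrite (mulmxA f _ x) (mulmxA f _ y) adjr // !mul1mx.
Qed.
Lemma isom1 : isomQ 1. Proof. by rewrite /isomQ trmx1 mul1mx mulmx1. Qed.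
Lemma isomM f g : isomQ f -> isomQ g -> isomQ (f *m g).
Proof. by rewrite /isomQ => h k; rewrite trmx_mul -!mulmxA (mulmxA f^T) (mulmxA _ f) h mulmxA. Qed.
Lemma isomX f k : isomQ f -> isomQ (f ^+ k).
Proof. by move=> h; elim: k => [|k ih]; [exact: isom1|rewrite exprS; apply: isomM]. Qed.
Lemma dot_adj f x y : isomQ f -> dot x (adj f *m y) = dot (f *m x) y.
Proof. by move=> h; rewrite -(isom_dot x _ h) (mulmxA f) adjr // mul1mx. Qed.

Lemma ModP f : Mod (QM n) f <-> isomQ f.
Proof.
split=> [[_ /isomP]//|h]; split; last by apply/isomP.
by exists (fun x => adj f *m x) => x; rewrite mulmxA ?adjl ?adjr ?mul1mx.
Qed.

End Form.

(** * Reversed Cauchy-Schwarz inequality in signature (1, n) *)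

Section Lorentz.
Variables (R : realDomainType) (n : nat).
Implicit Types x y v : 'cV[R]_n.+1.

(** Taken over any [realDomainType]: the same inequalities serve the integral lattice and the real
    hyperboloid in [ModPlus]. *)
Definition mink x y : R :=
  x ord0 ord0 * y ord0 ord0 - \sum_(i < n) x (lift ord0 i) ord0 * y (lift ord0 i) ord0.

Lemma mink_form x y : Defs.form (map_mx intr (QM n)) x y = mink x y.
Proof.
rewrite /Defs.form /mink /QM map_diag_mx mul_mx_diag mxE big_ord_recl !mxE /= mulr1.
rewrite -sumrN; congr (_ + _); apply: eq_bigr => i _.
by rewrite !mxE /= mulrN1 mulNr.
Qed.

Definition forward x := 0 < mink x x /\ 0 < x ord0 ord0.

(* The sum of the [(a d_i - c b_i)^2] is nonnegative, where [x = (a; b)] and [y = (c; d)]. *)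
Lemma mink_key x y :
  2 * (x ord0 ord0 * y ord0 ord0) *
    (\sum_(i < n) x (lift ord0 i) ord0 * y (lift ord0 i) ord0)
  <= x ord0 ord0 ^+ 2 * (y ord0 ord0 ^+ 2 - mink y y)
     + y ord0 ord0 ^+ 2 * (x ord0 ord0 ^+ 2 - mink x x).
Proof.
rewrite /mink -!expr2 !subKr -subr_ge0 !mulr_sumr -big_split -sumrB /=.
apply: sumr_ge0 => i _.
rewrite (_ : _ - _ = (x ord0 ord0 * y (lift ord0 i) ord0
  - y ord0 ord0 * x (lift ord0 i) ord0) ^+ 2) ?sqr_ge0 //; ring.
Qed.

Lemma forward_mink x y : forward x -> forward y -> 0 < mink x y.
Proof.
move=> [xx x0] [yy y0]; have := mink_key x y.
have -> : \sum_(i < n) x (lift ord0 i) ord0 * y (lift ord0 i) ord0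
  = x ord0 ord0 * y ord0 ord0 - mink x y by rewrite /mink subKr.
move: x0 y0 xx yy; set a := x ord0 ord0; set c := y ord0 ord0.
set p := mink x x; set q := mink y y; set r := mink x y => a0 c0 p0 q0 h.
have ac : 0 < a * c by rewrite mulr_gt0.
have a2 : 0 < a ^+ 2 * q by rewrite mulr_gt0 ?exprn_gt0.
have c2 : 0 < c ^+ 2 * p by rewrite mulr_gt0 ?exprn_gt0.
(* In these letters [h] amounts to a^2 q + c^2 p <= 2 a c r. *)
rewrite -(pmulr_rgt0 _ ac); nra.
Qed.

Lemma mink_forward x y : forward x -> 0 < mink y y -> 0 < mink x y -> 0 < y ord0 ord0.
Proof.
move=> fx yy xy; rewrite ltNge; apply/negP; rewrite le_eqVlt => /orP[/eqP y0|y0].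
  move: yy; rewrite /mink y0 mul0r sub0r oppr_gt0 => /lt_geF/negP; apply.
  by apply: sumr_ge0 => i _; rewrite -expr2 sqr_ge0.
have e z : mink z (- y) = - mink z y.
  rewrite /mink !mxE mulrN; under eq_bigr do rewrite mxE mulrN.
  by rewrite sumrN opprK opprB addrC.
have eN : mink (- y) (- y) = mink y y.
  rewrite e; rewrite /mink !mxE mulNr; under eq_bigr do rewrite mxE mulNr.
  by rewrite sumrN opprK opprD !opprK.
have /(forward_mink fx) : forward (- y) by split; rewrite ?eN // mxE oppr_gt0.
by rewrite e oppr_gt0 => /lt_trans/(_ xy); rewrite ltxx.
Qed.

(** Hodge index theorem: as the spatial products of [x] and [v] add up to x_0 v_0, [mink_key]
    becomes x_0^2 (v . v) + v_0^2 (x . x) <= 0. *)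
Lemma mink_orth x v : forward v -> mink x v = 0 -> x != 0 -> mink x x < 0.
Proof.
move=> [vv v0] xv x0; rewrite ltNge; apply/negP => xx.
have S : \sum_(i < n) x (lift ord0 i) ord0 * v (lift ord0 i) ord0
  = x ord0 ord0 * v ord0 ord0 by apply/esym/eqP; rewrite -subr_eq0; apply/eqP.
have := mink_key x v; rewrite S.
have [a0|a0] := eqVneq (x ord0 ord0) 0; last first.
  have a2 : 0 < x ord0 ord0 ^+ 2 * mink v v by rewrite mulr_gt0 // lt0r sqrf_eq0 a0 sqr_ge0.
  have := mulr_ge0 (sqr_ge0 (v ord0 ord0)) xx; nra.
move: xx; rewrite /mink a0 mul0r sub0r oppr_ge0 => h _.
case/negP: x0; apply/eqP/matrixP => i j; rewrite ord1 mxE.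
case: (unliftP ord0 i) => [k|] -> //.
have : \sum_(i < n) x (lift ord0 i) ord0 ^+ 2 = 0.
  apply/eqP; rewrite eq_le; apply/andP; split; first by move: h; under eq_bigr do rewrite -expr2.
  by apply: sumr_ge0 => l _; rewrite sqr_ge0.
move/eqP; rewrite psumr_eq0 => [/allP/(_ k)|l _]; last exact: sqr_ge0.
by rewrite mem_index_enum sqrf_eq0 => /(_ isT)/eqP.
Qed.

End Lorentz.

Section Coord.
Variable (n : nat).
Implicit Types x y u v : 'cV[int]_n.+1.

Lemma dot_mink x y : dot x y = mink x y.
Proof.
by rewrite -mink_form; congr Defs.form; apply/matrixP => i j; rewrite [RHS]mxE intz.
Qed.

Definition fwd x := 0 < dot x x /\ 0 < x ord0 ord0.

Lemma fwdE x : fwd x <-> forward x.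
Proof. by rewrite /fwd /forward dot_mink. Qed.

Lemma fwd_dot x y : fwd x -> fwd y -> 0 < dot x y.
Proof. by rewrite dot_mink => /fwdE fx /fwdE; apply: forward_mink. Qed.

Lemma dot_fwd x y : fwd x -> 0 < dot y y -> 0 < dot x y -> fwd y.
Proof.
by move=> /fwdE fx yy xy; split=> //; apply: (mink_forward fx); rewrite -dot_mink.
Qed.

Lemma dot_orth x v : fwd v -> dot x v = 0 -> x != 0 -> dot x x < 0.
Proof. by rewrite !dot_mink => /fwdE; apply: mink_orth. Qed.

Lemma fwdD x y : fwd x -> fwd y -> fwd (x + y).
Proof.
move=> fx fy; have xy := fwd_dot fx fy; case: fx fy => xx x0 [yy y0].
by split; rewrite ?mxE ?addr_gt0 // !dotE (dotC y x) !addr_gt0.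
Qed.

(* The coordinates [(d; m_1, ..., m_n)] of [d H - m_1 E_1 - ... - m_n E_n], padded by zeros. *)
Definition mc x (i : nat) : int :=
  if i == 0%N then x ord0 ord0 else if (i <= n)%N then - x (inord i) ord0 else 0.

Lemma mc0 x : mc x 0 = x ord0 ord0. Proof. by []. Qed.

Lemma mcE x i : (0 < i <= n)%N -> mc x i = dot x (Ecl n i).
Proof. by move=> h; rewrite form_Ecl // /mc; case: i h => //= i ->. Qed.

Lemma mc_big x i : (n < i)%N -> mc x i = 0.
Proof. by rewrite /mc; case: i => // i; rewrite ltnNge => /negbTE ->. Qed.

Lemma mcD x y i : mc (x + y) i = mc x i + mc y i.
Proof. by rewrite /mc; case: eqP => _; [|case: leqP => _]; rewrite ?mxE ?opprD ?addr0. Qed.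

Lemma mcZ a x i : mc (a *: x) i = a * mc x i.
Proof. by rewrite /mc; case: eqP => _; [|case: leqP => _]; rewrite ?mxE ?mulrN ?mulr0. Qed.

Lemma mcN x i : mc (- x) i = - mc x i.
Proof. by rewrite -scaleN1r mcZ mulN1r. Qed.

Lemma mcB x y i : mc (x - y) i = mc x i - mc y i.
Proof. by rewrite mcD mcN. Qed.

Lemma mcH i : mc (Hcl n) i = (i == 0%N)%:R.
Proof.
rewrite /mc; case: (i =P 0%N) => [_|/eqP i0]; first by rewrite mxE.
by case: leqP => // h; rewrite HclE // (negbTE i0) oppr0.
Qed.

Lemma mcEcl j i : (0 < j <= n)%N -> mc (Ecl n j) i = - (i == j)%:R.
Proof.
move=> /andP[j0 h]; rewrite /mc; case: (i =P 0%N) => [->|/eqP i0].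
  by rewrite -inord00 EclE // ltn_eqF // oppr0.
by case: leqP => h'; [rewrite EclE | rewrite gtn_eqF ?oppr0 // (leq_ltn_trans h)].
Qed.

Lemma mcK i : mc (Kcl n) i = if i == 0%N then -3 else if (i <= n)%N then -1 else 0.
Proof.
rewrite /mc; case: (i =P 0%N) => [_|/eqP i0]; first by rewrite -inord00 KclE.
by case: leqP => // h; rewrite KclE // (negbTE i0).
Qed.

Lemma mc_inj x y : (forall i, (i <= n)%N -> mc x i = mc y i) -> x = y.
Proof.
move=> h; apply/matrixP => i j; rewrite ord1 -(inord_val i).
have := h i (leq_ord i); rewrite /mc leq_ord.
by case: (val i =P 0%N) => [->|_ /oppr_inj//]; rewrite inord00.
Qed.

(** The padding by zeros gives one polynomial expression for all n <= 8, on which [lia] and [nia]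
    can work. *)
Lemma dot_mc x y : (n <= 8)%N ->
  dot x y = mc x 0 * mc y 0 - (mc x 1 * mc y 1 + mc x 2 * mc y 2 + mc x 3 * mc y 3
    + mc x 4 * mc y 4 + mc x 5 * mc y 5 + mc x 6 * mc y 6 + mc x 7 * mc y 7
    + mc x 8 * mc y 8).
Proof.
move=> n8; rewrite dot_mink /mink !mc0; congr (_ - _).
rewrite (eq_bigr (fun i : 'I_n => mc x i.+1 * mc y i.+1)); last first.
  move=> i _; rewrite /mc /= !ltn_ord mulrNN.
  by have -> : lift ord0 i = inord i.+1 by apply/val_inj; rewrite /= inordK ?ltnS.
rewrite (big_ord_widen 8 (fun i => mc x i.+1 * mc y i.+1)) // big_mkcond.
rewrite (eq_bigr (fun i : 'I_8 => mc x i.+1 * mc y i.+1)); last first.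
  by move=> i _; case: ltnP => // h; rewrite mc_big ?mul0r.
by rewrite !big_ord_recl big_ord0 /= addr0 !addrA.
Qed.

End Coord.

(** * Mod^+ as the group of isometries preserving the forward cone *)

Section ModPlus.
Variables (R : realType) (n : nat).
Implicit Types (x : 'cV[R]_n.+1) (u v : 'cV[int]_n.+1) (f g : 'M[int]_n.+1).

Let rQ : 'M[R]_n.+1 := map_mx intr (QM n).
Let rv v : 'cV[R]_n.+1 := map_mx intr v.
Let rm f : 'M[R]_n.+1 := map_mx intr f.

Let form_rv u v : Defs.form rQ (rv u) (rv v) = (dot u v)%:~R.
Proof. by rewrite /Defs.form /rQ /rv map_trmx -!map_mxM mxE. Qed.

Let form_rm f x y : isomQ f -> Defs.form rQ (rm f *m x) (rm f *m y) = Defs.form rQ x y.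
Proof.
move=> h; rewrite /Defs.form trmx_mul.
have e : (rm f)^T *m rQ *m rm f = rQ by rewrite /rm /rQ map_trmx -!map_mxM h.
by rewrite -[in RHS]e !mulmxA.
Qed.

Let upper_fwd f v x : isomQ f -> fwd v -> fwd (f *m v) ->
  upper_sheet x -> upper_sheet (rm f *m x).
Proof.
move=> h [vv v0] [fvv fv0] [xx x0]; split; first by rewrite /hyperboloid form_rm.
have rf w : fwd w -> forward (rv w).
  by move=> [ww w0]; split; rewrite -?mink_form ?form_rv ?mxE ltr0z.
apply: (mink_forward (x := rv (f *m v))); first exact: rf.
  by rewrite -mink_form form_rm // xx ltr01.
rewrite -mink_form /rv map_mxM form_rm // mink_form.
by apply: forward_mink; [apply: rf | split; rewrite -?mink_form ?xx ?ltr01].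
Qed.

(** One forward vector with forward image is enough: a point of the hyperboloid lies on the upper
    sheet as soon as its product with some forward vector is positive, and isometries preserve
    products. *)
Lemma fwd_ModPlus f v : isomQ f -> fwd v -> fwd (f *m v) -> ModPlus R f.
Proof.
move=> h fv ffv; have h' := isom_adj h.
have back : adj f *m (f *m v) = v by rewrite mulmxA adjl // mul1mx.
have up x : upper_sheet (rm f *m x) <-> upper_sheet x.
  split=> [u|]; last exact: upper_fwd fv ffv.
  have := @upper_fwd (adj f) (f *m v) _ h' ffv _ u.
  by rewrite back mulmxA -map_mxM adjl // map_mx1 mul1mx => /(_ fv).
have lo x : lower_sheet x <-> upper_sheet (- x).
  rewrite /lower_sheet /upper_sheet /hyperboloid mxE oppr_gt0.
  suff -> : Defs.form rQ (- x) (- x) = Defs.form rQ x x by [].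
  rewrite /Defs.form (_ : (- x)^T = - x^T) ?mulNmx ?mulmxN ?opprK ?mulNmx ?opprK //.
  by apply/matrixP => i j; rewrite !mxE.
by split=> [|//|x]; [apply/ModP | rewrite !lo -mulmxN; apply: up].
Qed.

Lemma ModPlus_isom f : ModPlus R f -> isomQ f.
Proof. by case=> /ModP. Qed.

Lemma ModPlus_fwd f v : ModPlus R f -> fwd v -> fwd (f *m v).
Proof.
move=> hf [vv v0]; have h := ModPlus_isom hf; case: hf => _ hu _.
split; first by rewrite isom_dot.
(* [ModPlus] speaks only of vectors of square 1, hence the rescaling over the reals. *)
pose s : R := Num.sqrt (dot v v)%:~R.
have s0 : 0 < s by rewrite sqrtr_gt0 ltr0z.
have : upper_sheet (s^-1 *: rv v).
  split; last by rewrite !mxE mulr_gt0 ?invr_gt0 ?ltr0z.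
  rewrite /hyperboloid /Defs.form (_ : (s^-1 *: rv v)^T = s^-1 *: (rv v)^T); last first.
    by apply/matrixP => i j; rewrite !mxE.
  rewrite -!scalemxAl -scalemxAr scalerA mxE.
  have := form_rv v v; rewrite /Defs.form => ->.
  by rewrite -invfM -expr2 sqr_sqrtr ?ler0z ?ltW // mulVf // intr_eq0 gt_eqF.
move/hu => [_]; rewrite -scalemxAr -map_mxM mxE [X in _ * X]mxE pmulr_rgt0 ?invr_gt0 //.
by rewrite ltr0z.
Qed.

Lemma ModPlusP f v : isomQ f -> fwd v -> ModPlus R f <-> fwd (f *m v).
Proof. by move=> h fv; split=> [/ModPlus_fwd|]; [apply | apply: fwd_ModPlus fv]. Qed.

Lemma fwdH : fwd (Hcl n).
Proof. by split; rewrite ?form_Hcl mxE. Qed.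

Lemma ModPlusM f g : ModPlus R f -> ModPlus R g -> ModPlus R (f *m g).
Proof.
move=> hf hg; apply/(ModPlusP _ fwdH); first by apply: isomM; apply: ModPlus_isom.
by rewrite -mulmxA; apply: ModPlus_fwd => //; apply: ModPlus_fwd fwdH.
Qed.

Lemma ModPlus1 : ModPlus R (1%:M : 'M_n.+1).
Proof. by apply/(ModPlusP _ fwdH); [exact: isom1 | rewrite mul1mx; exact: fwdH]. Qed.

Lemma ModPlus_adj f : ModPlus R f -> ModPlus R (adj f).
Proof.
move=> hf; have h := ModPlus_isom hf.
apply: (@fwd_ModPlus _ (f *m Hcl n)); first exact: isom_adj.
  exact: ModPlus_fwd fwdH.
by rewrite mulmxA adjl // mul1mx; exact: fwdH.
Qed.

Lemma ModPlusX f k : ModPlus R f -> ModPlus R (f ^+ k).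
Proof. by move=> h; elim: k => [|k ih]; [exact: ModPlus1|rewrite exprS; apply: ModPlusM]. Qed.

Lemma isom_fwd f v : isomQ f -> fwd v -> f *m v = v -> ModPlus R f.
Proof. by move=> h fv e; apply/(ModPlusP h fv); rewrite e. Qed.

End ModPlus.

(** * The fundamental chamber *)

Section Chamber.
Variables (R : realType) (n : nat).
Hypothesis (hn : (3 <= n <= 8)%N).
Implicit Types (x y u v : 'cV[int]_n.+1) (f g : 'M[int]_n.+1).

Let n3 : (3 <= n)%N. Proof. by case/andP: hn. Qed.
Let n8 : (n <= 8)%N. Proof. by case/andP: hn. Qed.

Lemma dotH x : dot x (Hcl n) = mc x 0.
Proof. exact: form_Hcl. Qed.

Lemma isom_refl v : (2 %/ dot v v)%Z * dot v v = 2 -> isomQ (refl v).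
Proof.
move=> h; apply/isomP => x y; rewrite !refl_mul !dotE (dotC v y).
move: h; set c := (_ %/ _)%Z; set p := dot v v; set a := dot x v; set b := dot y v => h.
apply/eqP; rewrite -subr_eq0; apply/eqP; transitivity (c * a * b * (c * p - 2)); first by ring.
by rewrite h subrr mulr0.
Qed.

Lemma dotEE i j : (0 < i <= n)%N -> (0 < j <= n)%N ->
  dot (Ecl n i) (Ecl n j) = - (i == j)%:R.
Proof. by move=> hi hj; rewrite -mcE // mcEcl // eq_sym. Qed.

Lemma dotKE i : (0 < i <= n)%N -> dot (Kcl n) (Ecl n i) = -1.
Proof. by move=> h; rewrite -mcE // mcK; case: i h => // i /andP[_ ->]. Qed.

Lemma dotKK : dot (Kcl n) (Kcl n) = 9 - n%:Z.
Proof.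
rewrite dot_mc // !mcK; move: hn.
by case: (n) => [|[|[|[|[|[|[|[|[|m]]]]]]]]].
Qed.

Lemma fwdK : fwd (- Kcl n).
Proof.
split; first by rewrite dotNl dotNr opprK dotKK; lia.
by have := mcK n 0; rewrite mc0 !mxE => ->.
Qed.

(** Vinberg's simple roots of Mod^+(M_n): the chamber is bounded by the walls of W_n and the wall of
    E_n. *)
Definition vroots := rcons (simple_roots n) (Ecl n n).

Lemma simple_cases (P : 'cV[int]_n.+1 -> Prop) :
  P (Hcl n - Ecl n 1 - Ecl n 2 - Ecl n 3) ->
  (forall i, (0 < i < n)%N -> P (Ecl n i - Ecl n i.+1)) ->
  forall v, v \in simple_roots n -> P v.
Proof.
move=> h0 hi v; rewrite inE => /orP[/eqP->//|/mapP[i]].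
by rewrite mem_iota => hi' ->; apply: hi; lia.
Qed.

Lemma dot_r0 x : dot x (Hcl n - Ecl n 1 - Ecl n 2 - Ecl n 3)
  = mc x 0 - mc x 1 - mc x 2 - mc x 3.
Proof. by rewrite !dotBr dotH -!mcE //; lia. Qed.

Lemma dot_ri x i : (0 < i < n)%N -> dot x (Ecl n i - Ecl n i.+1) = mc x i - mc x i.+1.
Proof. by move=> h; rewrite dotBr -!mcE //; lia. Qed.

Lemma mem_r0 : Hcl n - Ecl n 1 - Ecl n 2 - Ecl n 3 \in simple_roots n.
Proof. exact: mem_head. Qed.

Lemma mem_ri i : (0 < i < n)%N -> Ecl n i - Ecl n i.+1 \in simple_roots n.
Proof.
by move=> h; rewrite inE (map_f (fun i => Ecl n i - Ecl n i.+1)) ?orbT // mem_iota; lia.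
Qed.

Lemma vroot_isom v : v \in vroots -> isomQ (refl v).
Proof.
rewrite mem_rcons inE => /orP[/eqP->|/(simple_rootP n3)[vv _]]; apply: isom_refl.
  by rewrite dotEE ?eqxx //; lia.
by rewrite vv.
Qed.

Lemma vroot_coef v : v \in vroots -> (2 %/ dot v v)%Z < 0.
Proof.
rewrite mem_rcons inE => /orP[/eqP->|/(simple_rootP n3)[-> _]] //.
by rewrite dotEE ?eqxx //; lia.
Qed.

Lemma vroot_sub : {subset simple_roots n <= vroots}.
Proof. by move=> v; rewrite mem_rcons inE => ->; rewrite orbT. Qed.

Lemma simple_fixK v : v \in simple_roots n -> refl v *m Kcl n = Kcl n.
Proof. by move=> /(refl_weyl n3)[]. Qed.

Lemma vroot_ModPlus v : v \in vroots -> ModPlus R (refl v).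
Proof.
move=> hv; have h := vroot_isom hv; move: hv; rewrite mem_rcons inE => /orP[/eqP e|hv].
  apply: (isom_fwd R h (fwdH n)); rewrite e refl_mul dotC dotH mcEcl; last by lia.
  by rewrite (_ : 0%N == n = false) ?oppr0 ?mulr0 ?scale0r ?subr0 //; lia.
by apply: (isom_fwd R h fwdK); rewrite mulmxN simple_fixK.
Qed.

Lemma prod_ModPlus s : {subset s <= vroots} -> ModPlus R (\prod_(v <- s) refl v).
Proof.
elim: s => [|v s ih] h; first by rewrite big_nil; apply: ModPlus1.
rewrite big_cons; apply: ModPlusM; first by apply: vroot_ModPlus; apply: h; rewrite mem_head.
by apply: ih => w hw; apply: h; rewrite inE hw orbT.
Qed.

Lemma prod_fixK s : {subset s <= simple_roots n} ->
  (\prod_(v <- s) refl v) *m Kcl n = Kcl n.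
Proof.
elim: s => [|v s ih] h; first by rewrite big_nil mul1mx.
rewrite big_cons -mulmxA ih ?simple_fixK //; first by apply: h; rewrite mem_head.
by move=> w hw; apply: h; rewrite inE hw orbT.
Qed.

(** The vector (3 n; n, n - 1, ..., 1), interior to the chamber; the product with it measures the
    descent. *)
Definition rho : 'cV[int]_n.+1 :=
  \col_(i < n.+1) if i == ord0 then 3 * n%:Z else i%:Z - n.+1%:Z.

Lemma mc_rho i : mc rho i = if i == 0%N then 3 * n%:Z else if (i <= n)%N then n.+1%:Z - i%:Z else 0.
Proof.
rewrite /mc; case: (i =P 0%N) => [_|/eqP i0]; first by rewrite mxE.
case: leqP => // h; rewrite mxE -val_eqE /= inordK // (negbTE i0); lia.
Qed.

Lemma fwd_rho : fwd rho.
Proof.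
split; last by rewrite -mc0 mc_rho /=; lia.
rewrite dot_mc // !mc_rho; move: hn.
by case: (n) => [|[|[|[|[|[|[|[|[|m]]]]]]]]].
Qed.

Lemma rho_pos v : v \in vroots -> 0 < dot rho v.
Proof.
rewrite mem_rcons inE => /orP[/eqP->|]; first by rewrite -mcE ?mc_rho; repeat case: ifP; lia.
move: v; apply: simple_cases => [|i h]; first by rewrite dot_r0 !mc_rho /=; repeat case: ifP => ?; lia.
by rewrite dot_ri // !mc_rho; repeat case: ifP; lia.
Qed.

Lemma dot_refl u v w : dot (refl v *m u) w = dot u w - (2 %/ dot v v)%Z * dot u v * dot v w.
Proof. by rewrite refl_mul dotBl dotZl. Qed.

Lemma dot_refl_lt u v w : v \in vroots -> dot u v < 0 -> 0 < dot w v ->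
  dot (refl v *m u) w < dot u w.
Proof.
move=> hv uv wv; rewrite dot_refl -subr_gt0 opprB addrC subrK (dotC v).
by rewrite pmulr_lgt0 // nmulr_rgt0 // vroot_coef.
Qed.

Lemma dot_refl_le u v w : v \in vroots -> dot u v < 0 -> 0 <= dot w v ->
  dot (refl v *m u) w <= dot u w.
Proof.
move=> hv uv wv; rewrite dot_refl -subr_ge0 opprB addrC subrK (dotC v).
by rewrite mulr_ge0 // ltW // nmulr_rgt0 // vroot_coef.
Qed.

Definition dominant (L : seq 'cV[int]_n.+1) u := all (fun v => 0 <= dot u v) L.

(* Each reflection lowers the positive integer [dot u rho]. *)
Lemma descent_ind (L : seq 'cV[int]_n.+1) (P : 'cV[int]_n.+1 -> Prop) :
  {subset L <= vroots} ->
  (forall u, fwd u -> dominant L u -> P u) ->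
  (forall u v, fwd u -> v \in L -> dot u v < 0 -> P (refl v *m u) -> P u) ->
  forall u, fwd u -> P u.
Proof.
move=> hL hdom hstep u; have [k] := ubnP `|dot u rho|%N.
elim: k u => // k ih u hk fu; case/boolP: (dominant L u) => [/hdom/(_)|]; first exact.
case/allPn => v hv; rewrite -ltNge => uv; apply: (hstep _ v) => //.
have hv' := hL _ hv.
have fr : fwd (refl v *m u) by apply: ModPlus_fwd fu; apply: vroot_ModPlus.
apply: ih => //; have := fwd_dot fr fwd_rho; have := fwd_dot fu fwd_rho.
by have := dot_refl_lt hv' uv (rho_pos hv'); lia.
Qed.

Lemma descent (L : seq 'cV[int]_n.+1) u : {subset L <= vroots} -> fwd u ->
  exists2 s, {subset s <= L} & dominant L ((\prod_(v <- s) refl v) *m u).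
Proof.
move=> hL; move: u; apply: (descent_ind hL) => [u fu hu|u v fu hv uv [s hs hd]].
  by exists [::] => //; rewrite big_nil mul1mx.
exists (rcons s v); last by rewrite -cats1 big_cat big_seq1 -mulmxA.
by move=> w; rewrite mem_rcons inE => /orP[/eqP->|/hs].
Qed.

End Chamber.

(** * Inequalities between integers in the chamber *)

Definition nef (d m1 m2 m3 m4 m5 m6 m7 m8 : int) :=
  [/\ m1 + m2 + m3 <= d, m2 <= m1, m3 <= m2, m4 <= m3 & 
  [/\ m5 <= m4, m6 <= m5, m7 <= m6, m8 <= m7 & 0 <= m8]].

(** In the expansion of d^2 >= (m_1 + m_2 + m_3)^2 the cross terms are at least m_2^2 + 5 m_3^2, and
    5 m_3^2 covers the five squares m_4^2, ..., m_8^2. *)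
Lemma nef_sq d m1 m2 m3 m4 m5 m6 m7 m8 : nef d m1 m2 m3 m4 m5 m6 m7 m8 ->
  m2 ^+ 2 <= d * d - (m1 * m1 + m2 * m2 + m3 * m3 + m4 * m4 + m5 * m5 + m6 * m6 + m7 * m7 + m8 * m8).
Proof.
case=> h0 h1 h2 h3 [h4 h5 h6 h7 h8].
have sq (a b : int) : 0 <= a -> a <= b -> a * a <= b * b by move=> *; apply: ler_pM.
have p3 : 0 <= m3 by lia.
have q4 : m4 * m4 <= m3 * m3 by apply: sq; lia.
have q5 : m5 * m5 <= m3 * m3 by apply: sq; lia.
have q6 : m6 * m6 <= m3 * m3 by apply: sq; lia.
have q7 : m7 * m7 <= m3 * m3 by apply: sq; lia.
have q8 : m8 * m8 <= m3 * m3 by apply: sq; lia.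
have qd : (m1 + m2 + m3) * (m1 + m2 + m3) <= d * d by apply: sq; lia.
have q23 : m3 * m3 <= m2 * m3 by apply: ler_pM => //; lia.
have q13 : m3 * m3 <= m1 * m3 by apply: ler_pM => //; lia.
have q33 : m3 * m3 <= m2 * m2 by apply: sq.
have q12 : m2 * m2 <= m1 * m2 by apply: ler_pM; lia.
rewrite expr2; lia.
Qed.

Lemma nef_K d m1 m2 m3 m4 m5 m6 m7 m8 : nef d m1 m2 m3 m4 m5 m6 m7 m8 ->
  m1 <= 3 * d - (m1 + m2 + m3 + m4 + m5 + m6 + m7 + m8).
Proof. by case=> h0 h1 h2 h3 [h4 h5 h6 h7 h8]; lia. Qed.

Lemma sum_lt (a b1 b2 b3 b4 b5 b6 b7 b8 : int) : 1 <= a ->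
  b1 * b1 + b2 * b2 + b3 * b3 + b4 * b4 + b5 * b5 + b6 * b6 + b7 * b7 + b8 * b8 <= a * a + 1 ->
  b1 + b2 + b3 + b4 + b5 + b6 + b7 + b8 < 3 * a.
Proof.
move=> a1; set q := (X in X <= _) => h; rewrite ltNge; apply/negP; set s := (X in _ <= X) => h3.
have sq : s * s <= 8 * q.
  rewrite -subr_ge0 (_ : _ - _ =
    (b1 - b2) ^+ 2 + (b1 - b3) ^+ 2 + (b1 - b4) ^+ 2 + (b1 - b5) ^+ 2 + (b1 - b6) ^+ 2
    + (b1 - b7) ^+ 2 + (b1 - b8) ^+ 2 + (b2 - b3) ^+ 2 + (b2 - b4) ^+ 2 + (b2 - b5) ^+ 2
    + (b2 - b6) ^+ 2 + (b2 - b7) ^+ 2 + (b2 - b8) ^+ 2 + (b3 - b4) ^+ 2 + (b3 - b5) ^+ 2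
    + (b3 - b6) ^+ 2 + (b3 - b7) ^+ 2 + (b3 - b8) ^+ 2 + (b4 - b5) ^+ 2 + (b4 - b6) ^+ 2
    + (b4 - b7) ^+ 2 + (b4 - b8) ^+ 2 + (b5 - b6) ^+ 2 + (b5 - b7) ^+ 2 + (b5 - b8) ^+ 2
    + (b6 - b7) ^+ 2 + (b6 - b8) ^+ 2 + (b7 - b8) ^+ 2); last by rewrite /s /q; ring.
  by rewrite !addr_ge0 // sqr_ge0.
have s3 : 3 * a * (3 * a) <= s * s by apply: ler_pM => //; lia.
have a2 : a <= 2.
  rewrite leNgt; apply/negP => a3; have : 3 * 3 <= a * a by apply: ler_pM; lia.
  lia.
have le (b : int) : b <= b * b by nia.
have : s <= q by rewrite /s /q !lerD ?le.
have [e|e] : a = 1 \/ a = 2 by lia.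
  by move: h h3; rewrite e; lia.
by move: h h3; rewrite e; lia.
Qed.

(* [d a - sum m_i b_i] is a combination of the forms [a], [a - b_1], [2 a - b_1 - b_2]
   and [3 a - b_1 - ... - b_j], with the nonnegative coefficients
   [d - m_1 - m_2 - m_3] and [m_j - m_(j+1)]. *)
Lemma nef_orth (d m1 m2 m3 m4 m5 m6 m7 m8 a b1 b2 b3 b4 b5 b6 b7 b8 : int) :
  nef d m1 m2 m3 m4 m5 m6 m7 m8 -> 1 <= a ->
  a * a - (b1 * b1 + b2 * b2 + b3 * b3 + b4 * b4 + b5 * b5 + b6 * b6 + b7 * b7 + b8 * b8) = -1 ->
  d * a - (m1 * b1 + m2 * b2 + m3 * b3 + m4 * b4 + m5 * b5 + m6 * b6 + m7 * b7 + m8 * b8) = 0 ->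
  m1 < d ->
  [/\ m3 = 0, d = m1 + m2, 0 < m2, [/\ a = 1, b1 = 1 & b2 = 1] &
   [/\ [/\ b3 = 0, b4 = 0 & b5 = 0], b6 = 0, b7 = 0 & b8 = 0]].
Proof.
case=> h0 h1 h2 h3 [h4 h5 h6 h7 h8] a1 sq orth dm.
have P (b : int) : 0 <= b * b by rewrite -expr2 sqr_ge0.
have S3 : b1 + b2 + b3 < 3 * a.
  have := @sum_lt a b1 b2 b3 0 0 0 0 0 a1; move: (P b4) (P b5) (P b6) (P b7) (P b8); lia.
have S4 : b1 + b2 + b3 + b4 < 3 * a.
  have := @sum_lt a b1 b2 b3 b4 0 0 0 0 a1; move: (P b5) (P b6) (P b7) (P b8); lia.
have S5 : b1 + b2 + b3 + b4 + b5 < 3 * a.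
  have := @sum_lt a b1 b2 b3 b4 b5 0 0 0 a1; move: (P b6) (P b7) (P b8); lia.
have S6 : b1 + b2 + b3 + b4 + b5 + b6 < 3 * a.
  have := @sum_lt a b1 b2 b3 b4 b5 b6 0 0 a1; move: (P b7) (P b8); lia.
have S7 : b1 + b2 + b3 + b4 + b5 + b6 + b7 < 3 * a.
  have := @sum_lt a b1 b2 b3 b4 b5 b6 b7 0 a1; move: (P b8); lia.
have S8 : b1 + b2 + b3 + b4 + b5 + b6 + b7 + b8 < 3 * a.
  have := @sum_lt a b1 b2 b3 b4 b5 b6 b7 b8 a1; lia.
have Q1 : b1 <= a.
  rewrite leNgt; apply/negP => ab; have : (a + 1) * (a + 1) <= b1 * b1 by apply: ler_pM; lia.
  move: (P b2) (P b3) (P b4) (P b5) (P b6) (P b7) (P b8); lia.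
have aa : a <= a * a by nia.
have q12 : (b1 + b2) * (b1 + b2) <= 2 * (b1 * b1 + b2 * b2).
  by move: (P (b1 - b2)); lia.
have Q2 : b1 + b2 <= 2 * a.
  rewrite leNgt; apply/negP => ab.
  have : (2 * a + 1) * (2 * a + 1) <= (b1 + b2) * (b1 + b2) by apply: ler_pM; lia.
  move: (P b3) (P b4) (P b5) (P b6) (P b7) (P b8); lia.
have abel : (d - m1 - m2 - m3) * a + (m1 - m2) * (a - b1) + (m2 - m3) * (2 * a - (b1 + b2))
  + (m3 - m4) * (3 * a - (b1 + b2 + b3)) + (m4 - m5) * (3 * a - (b1 + b2 + b3 + b4))
  + (m5 - m6) * (3 * a - (b1 + b2 + b3 + b4 + b5))
  + (m6 - m7) * (3 * a - (b1 + b2 + b3 + b4 + b5 + b6))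
  + (m7 - m8) * (3 * a - (b1 + b2 + b3 + b4 + b5 + b6 + b7))
  + m8 * (3 * a - (b1 + b2 + b3 + b4 + b5 + b6 + b7 + b8)) = 0 by rewrite -[RHS]orth; ring.
have M (c s : int) : 0 <= c -> 0 < s -> c <= c * s by move=> c0 s0; rewrite ler_peMr.
have N (c s : int) : 0 <= c -> 0 <= s -> 0 <= c * s by exact: mulr_ge0.
have t0 := M (d - m1 - m2 - m3) a ltac:(lia) ltac:(lia).
have t1 := N (m1 - m2) (a - b1) ltac:(lia) ltac:(lia).
have t2 := N (m2 - m3) (2 * a - (b1 + b2)) ltac:(lia) ltac:(lia).
have t3 := M (m3 - m4) (3 * a - (b1 + b2 + b3)) ltac:(lia) ltac:(lia).
have t4 := M (m4 - m5) (3 * a - (b1 + b2 + b3 + b4)) ltac:(lia) ltac:(lia).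
have t5 := M (m5 - m6) (3 * a - (b1 + b2 + b3 + b4 + b5)) ltac:(lia) ltac:(lia).
have t6 := M (m6 - m7) (3 * a - (b1 + b2 + b3 + b4 + b5 + b6)) ltac:(lia) ltac:(lia).
have t7 := M (m7 - m8) (3 * a - (b1 + b2 + b3 + b4 + b5 + b6 + b7)) ltac:(lia) ltac:(lia).
have t8 := M m8 (3 * a - (b1 + b2 + b3 + b4 + b5 + b6 + b7 + b8)) ltac:(lia) ltac:(lia).
(* All summands of [abel] vanish, and the strictly positive factors kill their coefficients: m_3 =
   ... = m_8 = 0 and d = m_1 + m_2. Then m_1 < d makes m_2 positive, so the factor 2 a - b_1 - b_2
   vanishes. *)
have m30 : m3 = 0 by lia.
have dd : d = m1 + m2 by lia.
have m2p : 0 < m2 by lia.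
have e2 : (m2 - m3) * (2 * a - (b1 + b2)) = 0 by lia.
have {}e2 : b1 + b2 = 2 * a by move/eqP: e2; rewrite mulf_eq0 => /orP[] /eqP; lia.
(* From b_1 + b_2 = 2 a one gets 2 a^2 <= b_1^2 + b_2^2 <= a^2 + 1. *)
have a11 : a = 1.
  move: q12; rewrite e2; move: (P b3) (P b4) (P b5) (P b6) (P b7) (P b8) => *.
  have : a * a <= 1 by lia.
  by nia.
have e1 : b1 = 1 /\ b2 = 1.
  move: q12 (P (b1 - b2)) Q1; rewrite e2 a11.
  move: (P b3) (P b4) (P b5) (P b6) (P b7) (P b8) sq; rewrite a11 => *.
  have e : b2 = 2 - b1 by lia.
  subst b2; suff : b1 = 1 by lia.
  have : (b1 - 1) * (b1 - 1) <= 0 by lia.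
  nia.
case: e1 => e1 e3.
have Z (b : int) : b * b <= 0 -> b = 0 by nia.
split=> //; split; first split; try apply: Z;
  move: (P b3) (P b4) (P b5) (P b6) (P b7) (P b8) sq; rewrite a11 e1 e3; lia.
Qed.

Lemma sum_sq1 (n : nat) (F : 'I_n -> int) : \sum_i F i * F i = 1 ->
  exists i, (F i = 1 \/ F i = -1) /\ forall j, j != i -> F j = 0.
Proof.
move=> s1; case: (pickP (fun i => F i != 0)) => [i Fi|F0]; last first.
  by move: s1; rewrite big1 // => i _; move/negbFE/eqP: (F0 i) => ->; rewrite mul0r.
exists i; move: s1; rewrite (bigD1 i) //=; set S := \sum_(_ | _) _ => s1.
have S0 : 0 <= S by apply: sumr_ge0 => j _; rewrite -expr2 sqr_ge0.
split; first by move: Fi => /eqP; nia.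
have {}S0 : S = 0 by move: Fi => /eqP; nia.
move=> j ji; move/eqP: S0; rewrite psumr_eq0 => [/allP/(_ j)|k _]; last by rewrite -expr2 sqr_ge0.
by rewrite mem_index_enum ji /= mulf_eq0 orbb => /(_ isT)/eqP.
Qed.

Notation nef_class x := (nef (mc x 0) (mc x 1) (mc x 2) (mc x 3) (mc x 4) (mc x 5) (mc x 6)
  (mc x 7) (mc x 8)).

Section Orth.
Variables (R : realType) (n : nat).
Hypothesis (hn : (3 <= n <= 8)%N).
Implicit Types (x y u v e : 'cV[int]_n.+1) (f g : 'M[int]_n.+1).

Let n3 : (3 <= n)%N. Proof. by case/andP: hn. Qed.
Let n8 : (n <= 8)%N. Proof. by case/andP: hn. Qed.

Lemma dot_sum x y : dot x y = mc x 0 * mc y 0 - \sum_(i < n) mc x i.+1 * mc y i.+1.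
Proof.
rewrite dot_mink /mink !mc0; congr (_ - _); apply: eq_bigr => i _.
rewrite /mc /= !ltn_ord mulrNN.
by have -> : lift ord0 i = inord i.+1 by apply/val_inj; rewrite /= inordK ?ltnS.
Qed.

Lemma dominant_simple v : dominant (simple_roots n) v ->
  mc v 1 + mc v 2 + mc v 3 <= mc v 0 /\ forall i, (0 < i < n)%N -> mc v i.+1 <= mc v i.
Proof.
move=> /allP h; split; first by have := h _ (mem_r0 n); rewrite dot_r0 //; lia.
by move=> i hi; have := h _ (mem_ri hn hi); rewrite dot_ri //; lia.
Qed.

Lemma simple_nef v : dominant (simple_roots n) v -> 0 <= mc v n ->
  nef_class v.
Proof.
move=> /dominant_simple[h0 hi] hn0.
have H i : (0 < i)%N -> mc v i.+1 <= mc v i.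
  move=> i0; case: (ltngtP i n) => [hin|hin|->]; first by apply: hi; rewrite i0.
    by rewrite !mc_big // ltnW.
  by rewrite (mc_big _ (ltnSn n)).
have h8 : 0 <= mc v 8.
  by move: n8; rewrite leq_eqVlt => /orP[/eqP <-//|h]; rewrite mc_big.
by split; [|exact: H..|split]; rewrite ?H.
Qed.

Lemma vroots_dominant v : dominant (vroots n) v <-> dominant (simple_roots n) v /\ 0 <= mc v n.
Proof.
by rewrite /dominant all_rcons -mcE ?leqnn ?andbT; [split=> [/andP[]|[-> ->]]|lia].
Qed.

Lemma vroots_nef v : dominant (vroots n) v ->
  nef_class v.
Proof. by move=> /vroots_dominant[]; apply: simple_nef. Qed.

Lemma nef_lt v : fwd v -> 
  nef_class v ->
  mc v 1 < mc v 0.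
Proof.
move=> [vv v0] h; move: vv; rewrite dot_mc //.
have P (b : int) : 0 <= b * b by rewrite -expr2 sqr_ge0.
case: h => h0 h1 h2 h3 [h4 h5 h6 h7 h8] vv; rewrite -mc0 in v0.
rewrite ltNge; apply/negP => h.
have : mc v 0 * mc v 0 <= mc v 1 * mc v 1 by apply: ler_pM; lia.
move: (P (mc v 2)) (P (mc v 3)) (P (mc v 4)) (P (mc v 5)) (P (mc v 6)) (P (mc v 7)) (P (mc v 8)).
lia.
Qed.

Definition line12 : 'cV[int]_n.+1 := Hcl n - Ecl n 1 - Ecl n 2.

(** Up to sign [e] has degree at least 0. Degree 0 leaves only the classes E_i up to sign; positive
    degree is the situation of [nef_orth], whose answer H - E_1 - E_2 is the line through two
    points, contracted when [v] comes from the quadric CP^1 x CP^1. *)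
Lemma orth_class v e : fwd v -> dominant (vroots n) v -> dot e e = -1 -> dot v e = 0 ->
  (exists i, [/\ (0 < i <= n)%N, mc v i = 0 & e = Ecl n i \/ e = - Ecl n i])
  \/ [/\ mc v 3 = 0, mc v 0 = mc v 1 + mc v 2, 0 < mc v 2 & e = line12 \/ e = - line12].
Proof.
move=> fv dv; wlog : e / 0 <= mc e 0.
  move=> W ee ve; have [e0|e0] := lerP 0 (mc e 0); first exact: W.
  case: (W (- e)); rewrite ?mcN ?oppr_ge0 ?ltW // ?dotNl ?dotNr ?opprK ?ve ?oppr0 //.
    move=> [i [h1 h2 h3]]; left; exists i; split => //.
    by case: h3 => /(canRL (@opprK _)) ->; auto; rewrite opprK; auto.
  move=> [h1 h2 h3 h4]; right; split => //.
  by case: h4 => /(canRL (@opprK _)) ->; auto; rewrite opprK; auto.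
move=> e0 ee ve; have hnef := vroots_nef dv.
have [a0|a0] := eqVneq (mc e 0) 0; last first.
  right; have [] := nef_orth hnef _ _ _ (nef_lt fv hnef) (a := mc e 0)
    (b1 := mc e 1) (b2 := mc e 2) (b3 := mc e 3) (b4 := mc e 4) (b5 := mc e 5)
    (b6 := mc e 6) (b7 := mc e 7) (b8 := mc e 8).
  - by lia.
  - by rewrite -ee dot_mc.
  - by rewrite -ve dot_mc.
  move=> -> -> m2 [a1 b1 b2] [[b3 b4 b5] b6 b7 b8]; split=> //; left.
  apply: mc_inj => i hi; rewrite /line12 !mcB mcH !mcEcl; try lia.
  by move: (leq_trans hi n8); case: i hi => [|[|[|[|[|[|[|[|[|i]]]]]]]]] // _ _;
    rewrite ?a1 ?b1 ?b2 ?b3 ?b4 ?b5 ?b6 ?b7 ?b8.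
left; move: ee; rewrite dot_sum a0 mul0r sub0r => /oppr_inj.
case/(@sum_sq1 n (fun i => mc e i.+1)) => i [hi hj].
have eE : e = - mc e i.+1 *: Ecl n i.+1.
  apply: mc_inj => -[|j] hjn; rewrite mcZ mcEcl ?ltn_ord //= ?oppr0 ?mulr0 //.
  rewrite eqSS; case: eqP => [->|ji]; first by rewrite mulrN1 opprK.
  by rewrite oppr0 mulr0 (hj (Ordinal hjn)) // -val_eqE /=; apply/eqP.
exists i.+1; split; first by rewrite /= ltn_ord.
  move: ve; rewrite eE dotZr -mcE ?ltn_ord // => /eqP; rewrite mulf_eq0 => /orP[|/eqP//].
  by case: hi => ->.
by rewrite eE; case: hi => ->; rewrite ?opprK ?scaleN1r ?scale1r; auto.
Qed.

End Orth.

(** * Reducibility *)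

Lemma gram_isometry (r s : nat) (G : 'M[int]_r) (G' : 'M[int]_s) (P : 'M[int]_(s, r)) :
  G *m G = 1%:M -> P *m (G *m P^T *m G') = 1%:M -> P^T *m G' *m P = G ->
  Defs.isometry G G' P.
Proof.
move=> GG PP' e; split; last first.
  by move=> x y; rewrite /Defs.form trmx_mul -[in RHS]e !mulmxA.
have P'P : (G *m P^T *m G') *m P = 1%:M by rewrite -!mulmxA (mulmxA P^T) e GG.
by exists (fun x => (G *m P^T *m G') *m x) => x; rewrite mulmxA ?PP' ?P'P mul1mx.
Qed.

Lemma gram_Mod (r : nat) (G A : 'M[int]_r) : G *m G = 1%:M -> A^T *m G *m A = G -> Mod G A.
Proof.
move=> GG e; apply: gram_isometry => //; apply: mulmx1C.
by rewrite -!mulmxA (mulmxA A^T) e GG.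
Qed.

Lemma Qneg2 k : Qneg k *m Qneg k = 1%:M.
Proof. by rewrite /Qneg mulNmx mulmxN opprK mul1mx. Qed.

Lemma QdP2 M : QdP M *m QdP M = 1%:M.
Proof.
case: M => [||k hk] /=; [by rewrite mul1mx | | exact: QM2].
apply/matrixP => i j; rewrite !mxE !big_ord_recl big_ord0 !mxE.
by case: i => -[|[|i]] //= hi; case: j => -[|[|j]] //= hj.
Qed.

Section Split.
Variables (n : nat) (M : delPezzo) (k : nat) (P : 'M[int]_(n.+1, b2 M + k)) (f : 'M[int]_n.+1).
Let G := block_mx (QdP M) 0 0 (Qneg k).

(** In the frame [P] the matrix of [f] is F = G (P^T Q f P), so the vanishing of the mixed products
    makes F block diagonal. Comparing blocks in F^T G F = G makes both blocks isometries. *)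
Lemma reducible_of_frame : (0 < k)%N -> isomQ f ->
  P^T *m QM n *m P = G -> P *m (G *m P^T *m QM n) = 1%:M ->
  (forall i j, dot (col (lshift k i) P) (f *m col (rshift _ j) P) = 0) ->
  (forall i j, dot (col (rshift _ j) P) (f *m col (lshift k i) P) = 0) ->
  reducible f.
Proof.
move=> k0 hf PG PP' ur dl.
have GG : G *m G = 1%:M.
  by rewrite /G mulmx_block !mulmx0 !mul0mx !addr0 !add0r QdP2 Qneg2 -scalar_mx_block.
have [S Sd] : exists S : 'M_(b2 M + k), S = P^T *m QM n *m f *m P by eexists.
have SE i j : S i j = dot (col i P) (f *m col j P).
  have -> : f *m col j P = col j (f *m P) by rewrite !colE mulmxA.
  rewrite /Defs.form tr_col -row_mul Sd -!mulmxA mulmxA !mxE.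
  by apply: eq_bigr => l _; rewrite !mxE.
have S0 : S = block_mx (ulsubmx S) 0 0 (drsubmx S).
  rewrite -[LHS]submxK; congr block_mx; apply/matrixP => i j.
    by rewrite !mxE SE.
  by rewrite !mxE SE.
pose F := G *m S.
have FE : F = block_mx (QdP M *m ulsubmx S) 0 0 (Qneg k *m drsubmx S).
  by rewrite /F {1}S0 mulmx_block !mulmx0 !mul0mx !addr0 add0r.
have FG : F^T *m G *m F = G.
  have Gt : G^T = G by rewrite -PG !trmx_mul trmxK QM_sym mulmxA.
  have PF : P *m F = f *m P by rewrite /F Sd !mulmxA -(mulmxA P G) -(mulmxA P) PP' mul1mx.
  by rewrite -[X in _ *m X *m _]PG !mulmxA -trmx_mul -!mulmxA PF trmx_mul -!mulmxA
     (mulmxA f^T) (mulmxA _ f) hf mulmxA.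
exists M, k, P; split=> //; first exact: gram_isometry.
exists (QdP M *m ulsubmx S), (Qneg k *m drsubmx S).
move: FG; rewrite FE tr_block_mx !mulmx_block !trmx0 !mulmx0 !mul0mx !addr0 !add0r.
move=> /eq_block_mx[e1 _ _ e2]; split.
- by apply: gram_Mod => //; apply: QdP2.
- by apply: gram_Mod => //; apply: Qneg2.
by rewrite -FE /F Sd !mulmxA -(mulmxA P G) -(mulmxA P) PP' mul1mx.
Qed.

End Split.

Lemma reducible_conj n (f g : 'M[int]_n.+1) : isomQ g ->
  reducible (g *m f *m adj g) -> reducible f.
Proof.
move=> hg [M [k [P [k0 [[Q' PQ QP] hP] [a [b [ha hb e]]]]]]].
exists M, k, (adj g *m P); split=> //.
  split.
    exists (fun x => Q' (g *m x)) => x /=; first by rewrite mulmxA mulmxA adjr // mul1mx PQ.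
    by rewrite -mulmxA QP mulmxA adjl // mul1mx.
  by move=> x y; rewrite -!(mulmxA (adj g)) (isom_dot _ _ (isom_adj hg)) hP.
exists a, b; split=> //.
by rewrite -mulmxA -e !mulmxA adjl // mul1mx.
Qed.

(** Imposing the condition on [f] and on its inverse covers both off-diagonal blocks, because c_l .
    f^-1 c_t = f c_l . c_t. *)
Lemma reducible_of_basis (n : nat) (M : delPezzo) (k : nat) (f : 'M[int]_n.+1)
    (c : nat -> 'cV[int]_n.+1) : (0 < k)%N -> n.+1 = (b2 M + k)%N ->
  isomQ f ->
  (forall i j : 'I_(b2 M + k), dot (c i) (c j) = block_mx (QdP M) 0 0 (Qneg k) i j) ->
  (forall g l t, g = f \/ g = adj f -> (l < b2 M)%N -> (b2 M <= t <= n)%N ->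
    dot (c l) (g *m c t) = 0) ->
  reducible f.
Proof.
move=> k0 e hf hG hc; pose G := block_mx (QdP M) 0 0 (Qneg k).
pose P : 'M[int]_(n.+1, b2 M + k) := \matrix_(i, j) c j i ord0.
have cP j : col j P = c j.
  by apply/matrixP => i l; rewrite !mxE (ord1 l).
have PG : P^T *m QM n *m P = G.
  apply/matrixP => i j; rewrite /G -hG -!cP /Defs.form tr_col -row_mul.
  by rewrite colE mulmxA -colE -row_mul !mxE.
have GG : G *m G = 1%:M.
  by rewrite /G mulmx_block !mulmx0 !mul0mx !addr0 !add0r QdP2 Qneg2 -scalar_mx_block.
apply: (@reducible_of_frame n M k P) => //.
- have : (G *m P^T *m QM n) *m P = 1%:M by rewrite -!mulmxA (mulmxA P^T) PG.
  move: (G *m _ *m _) => P'; move: (P) P'; rewrite -e => *; exact: mulmx1C.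
- move=> i j; rewrite !cP; apply: hc; [by left|by rewrite /= ltn_ord|].
  by rewrite /= leq_addr -ltnS e ltn_add2l ltn_ord.
move=> i j; rewrite !cP dotC -dot_adj //; apply: hc; [by right|by rewrite /= ltn_ord|].
by rewrite /= leq_addr -ltnS e ltn_add2l ltn_ord.
Qed.

Section Red.
Variables (R : realType) (n : nat).
Hypothesis (hn : (3 <= n <= 8)%N).
Implicit Types (x y u v e : 'cV[int]_n.+1) (f g : 'M[int]_n.+1).

Let n3 : (3 <= n)%N. Proof. by case/andP: hn. Qed.
Let n8 : (n <= 8)%N. Proof. by case/andP: hn. Qed.

Definition std_basis (t : nat) : 'cV[int]_n.+1 := if t == 0%N then Hcl n else Ecl n t.

Lemma dot_std i j : (i <= n)%N -> (j <= n)%N ->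
  dot (std_basis i) (std_basis j) = (if i == 0%N then 1 else -1) * (i == j)%:R.
Proof.
rewrite /std_basis; case: i => [|i]; case: j => [|j] hi hj //=.
- by rewrite dotH mcH.
- by rewrite dotC dotH mcEcl //= oppr0 mulr0.
- by rewrite dotH mcEcl //= oppr0 mulr0.
by rewrite dotEE // mulN1r.
Qed.

(** The decomposition of M_n as CP^1 x CP^1 blown up n - 1 times: H - E_1 and H - E_2 are the
    rulings, and H - E_1 - E_2, E_3, ..., E_n the exceptional classes orthogonal to them. *)
Definition quadric_basis (t : nat) : 'cV[int]_n.+1 :=
  if t == 0%N then Hcl n - Ecl n 1 else if t == 1%N then Hcl n - Ecl n 2 else
  if t == 2%N then line12 n else Ecl n t.

Lemma dot_quadric i j : (i <= n)%N -> (j <= n)%N ->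
  dot (quadric_basis i) (quadric_basis j) = if (2 <= i)%N then - (i == j)%:R else ((i + j == 1)%N)%:R.
Proof.
have h1 : (0 < 1 <= n)%N by lia.
have h2 : (0 < 2 <= n)%N by lia.
have ww : (mc (Hcl n) 0 = 1) /\ forall j, mc (Hcl n) j.+1 = 0.
  by split=> [|k]; rewrite mcH.
case: ww => w0 w1.
rewrite /quadric_basis /line12; case: i => [|[|[|i]]]; case: j => [|[|[|j]]] hi hj //=;
  rewrite ?dotBl ?dotBr ?dotH ?(dotC (Hcl n)) ?dotH ?mcH ?dotEE ?mcEcl //= ?eqSS ?eqxx; lia.
Qed.

(** By [orth_class] the (-1)-classes orthogonal to [v] are, up to sign, a basis of a negative
    definite summand, which [f] therefore preserves: H - E_1 - E_2, E_3, ..., E_n beside CP^1 x CP^1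
    in the degenerate case, otherwise E_(r+1), ..., E_n beside CP^2 (r = 0) or M_r. *)
Lemma dominant_fixed_reducible f v : isomQ f -> fwd v -> dominant (vroots n) v ->
  f *m v = v -> mc v n = 0 -> reducible f.
Proof.
move=> hf fv dv fvv vn.
have nefv := vroots_nef hn dv.
have fix' g : g = f \/ g = adj f -> isomQ g /\ g *m v = v.
  case=> ->; split => //; first exact: isom_adj.
  by rewrite -{1}fvv mulmxA adjl // mul1mx.
have cls g e : g = f \/ g = adj f -> dot e e = -1 -> dot v e = 0 ->
    dot (g *m e) (g *m e) = -1 /\ dot v (g *m e) = 0.
  move=> /fix'[hg gv] ee ve; rewrite isom_dot //; split=> //.
  by rewrite -[in LHS]gv isom_dot.
have [/and3P[/eqP m3 /eqP m0 m2]|hU] :=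
  boolP [&& mc v 3 == 0, mc v 0 == mc v 1 + mc v 2 & 0 < mc v 2].
  have mt t : (3 <= t <= n)%N -> mc v t = 0.
    have [_ _ _ h3 [h4 h5 h6 h7 h8]] := nefv.
    by case: t => [|[|[|[|[|[|[|[|[|t]]]]]]]]] ht //; lia.
  apply: (@reducible_of_basis n CP1xCP1 n.-1 f quadric_basis) => //; [lia|rewrite /=; lia| |].
    move=> i j; rewrite dot_quadric;
      [|have := ltn_ord i; rewrite /=; lia|have := ltn_ord j; rewrite /=; lia].
    case: (splitP i) => a ia; case: (splitP j) => b jb.
    - have -> : i = lshift _ a by apply/val_inj.
      have -> : j = lshift _ b by apply/val_inj.
      rewrite block_mxEul mxE /= leqNgt ltn_ord /= -val_eqE /=.
      by case: a {ia} => -[|[|a]] ha //; case: b {jb} => -[|[|b]] hb.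
    - have -> : i = lshift _ a by apply/val_inj.
      have -> : j = rshift _ b by apply/val_inj.
      rewrite block_mxEur mxE /= leqNgt ltn_ord /=.
      by case: a {ia} => -[|[|a]] ha.
    - have -> : i = rshift _ a by apply/val_inj.
      have -> : j = lshift _ b by apply/val_inj.
      rewrite block_mxEdl mxE /=.
      by case: b {jb} => -[|[|b]] hb.
    have -> : i = rshift _ a by apply/val_inj.
    have -> : j = rshift _ b by apply/val_inj.
    by rewrite block_mxEdr /Qneg !mxE /= -val_eqE.
  move=> g l t hg hl /andP[t2 tn].
  have [ve ee] : dot v (quadric_basis t) = 0 /\ dot (quadric_basis t) (quadric_basis t) = -1.
    rewrite dot_quadric // t2 eqxx; split=> //; rewrite /quadric_basis /line12.
    case: t t2 tn => [|[|[|t]]] // _ tn /=; first by rewrite !dotBr dotH -!mcE; lia.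
    by rewrite -mcE // mt.
  have [ee' ve'] := cls _ _ hg ee ve.
  have hl' : (l <= n)%N by move: hl => /=; lia.
  case: (orth_class hn fv dv ee' ve') => [[i [hi mi hE]]|[_ _ _ hE]].
    have i3 : (3 <= i)%N.
      rewrite ltnNge; apply/negP => i2; have [_ h1 _ _ _] := nefv.
      by case: i hi mi i2 {hE} => [|[|[|i]]] // _; lia.
    have : dot (quadric_basis l) (Ecl n i) = 0.
      have -> : Ecl n i = quadric_basis i.
        by rewrite /quadric_basis; case: i i3 {hi mi hE} => [|[|[|i]]].
      rewrite dot_quadric //; last by case/andP: hi.
      by move: hl => /=; case: l {hl'} => [|[|l]] // _; case: i i3 {hi mi hE} => [|[|[|i]]].
    by case: hE => -> // h; rewrite dotNr h oppr0.
  have : dot (quadric_basis l) (line12 n) = 0.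
    have -> : line12 n = quadric_basis 2 by [].
    by rewrite dot_quadric //; [move: hl => /=; case: l {hl'} => [|[|l]] | lia].
  by case: hE => -> // h; rewrite dotNr h oppr0.
(* The number r of positive m_i; it is less than n because m_n = 0, so that at least one class
   splits off. *)
have [r [rn rpos rzero]] : exists r, [/\ (r < n)%N, forall i, (0 < i <= r)%N -> 0 < mc v i
    & forall i, (r < i)%N -> mc v i = 0].
  have mono i : (0 < i)%N -> 0 <= mc v i.+1 <= mc v i.
    have [_ h1 h2 h3 [h4 h5 h6 h7 h8]] := nefv.
    case: i => [|[|[|[|[|[|[|[|[|i]]]]]]]]] // _; try lia;
      rewrite ?(mc_big v (i := 9)) ?(mc_big v (i := i.+4.+4.+1))
        ?(mc_big v (i := i.+4.+4.+2)); lia.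
  have mono' i j : (0 < i)%N -> (i <= j)%N -> mc v j <= mc v i.
    move=> i0 /subnK <-; elim: (j - i)%N => // d ih; rewrite addSn.
    by have /andP[_ h] := mono (d + i)%N ltac:(lia); apply: le_trans h ih.
  have nn i : (0 < i)%N -> 0 <= mc v i.
    by move=> i0; have /andP[h h'] := mono i i0; apply: le_trans h h'.
  have ex : exists i, (0 < i)%N && (mc v i == 0) by exists n; rewrite vn eqxx; lia.
  case: (ex_minnP ex) => i /andP[i0 /eqP mi] imin; exists i.-1; split.
  - by have := imin n; rewrite vn eqxx; lia.
  - move=> j hj; rewrite lt0r nn; last by lia.
    by rewrite andbT; apply/negP => mj; have := imin j; rewrite mj; lia.
  move=> j hj; have := mono' i j i0; rewrite mi; have := nn j; lia.
have hc g l t : g = f \/ g = adj f -> (l <= r)%N -> (r < t <= n)%N ->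
    dot (std_basis l) (g *m std_basis t) = 0.
  move=> hg hl /andP[ht tn].
  have t0 : (t == 0%N) = false by case: t ht {tn}.
  have [ve ee] : dot v (std_basis t) = 0 /\ dot (std_basis t) (std_basis t) = -1.
    rewrite dot_std // eqxx t0; split=> //; rewrite /std_basis t0.
    by rewrite -mcE ?rzero //; lia.
  have [ee' ve'] := cls _ _ hg ee ve.
  case: (orth_class hn fv dv ee' ve') => [[i [hi mi hE]]|[h1 h2 h3 _]]; last first.
    by case/negP: hU; rewrite h1 h2 h3 !eqxx.
  have ri : (r < i)%N by rewrite ltnNge; apply/negP => ir; have := rpos i; lia.
  have : dot (std_basis l) (Ecl n i) = 0.
    have -> : Ecl n i = std_basis i by rewrite /std_basis; case: i ri {hi mi hE}.
    rewrite dot_std; [|lia|lia].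
    by rewrite (_ : (l == i) = false) ?mulr0 //; lia.
  by case: hE => -> // h; rewrite dotNr h oppr0.
have blk (M : delPezzo) : b2 M = r.+1 -> (forall i j : 'I_(b2 M), QdP M i j
    = (if (i : nat) == 0%N then 1 else -1) * ((i : nat) == j)%:R) -> reducible f.
  move=> eM hM.
  apply: (@reducible_of_basis n M (n - r)%N f std_basis) => //; [lia|rewrite eM; lia| |].
    move=> i j; rewrite dot_std; [|have := ltn_ord i; lia|have := ltn_ord j; lia].
    case: (splitP i) => a ia; case: (splitP j) => b jb.
    - have -> : i = lshift _ a by apply/val_inj.
      have -> : j = lshift _ b by apply/val_inj.
      by rewrite block_mxEul hM.
    - have -> : i = lshift _ a by apply/val_inj.
      have -> : j = rshift _ b by apply/val_inj.
      rewrite block_mxEur [RHS]mxE.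
      suff -> : (lshift (n - r) a == rshift (b2 M) b :> nat) = false by rewrite mulr0.
      by apply/eqP => /=; have := ltn_ord a; lia.
    - have -> : i = rshift _ a by apply/val_inj.
      have -> : j = lshift _ b by apply/val_inj.
      rewrite block_mxEdl [RHS]mxE.
      suff -> : (rshift (b2 M) a == lshift (n - r) b :> nat) = false by rewrite mulr0.
      by apply/eqP => /=; have := ltn_ord b; lia.
    have -> : i = rshift _ a by apply/val_inj.
    have -> : j = rshift _ b by apply/val_inj.
    rewrite block_mxEdr /Qneg !mxE /= eqn_add2l -val_eqE /=.
    by rewrite (_ : (_ + _ == _)%N = false) ?mulN1r //; rewrite eM.
  by move=> g l t hg hl ht; apply: hc => //; lia.
case: (posnP r) => r0.
  apply: (blk CP2) => [|i j]; first by rewrite r0.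
  by rewrite !ord1 mxE.
have hr : (0 < r <= 8)%N by lia.
apply: (blk (Mk hr)) => //= i j; rewrite /QM !mxE -!val_eqE /=.
by case: (nat_of_ord i =P j) => [->|_]; rewrite ?mulr1 ?mulr0.
Qed.

(** After [v] is moved into the chamber, [orth_class] applied to the image of [e] yields some m_i =
    0, hence m_n = 0 by monotonicity. *)
Lemma fixed_orth_reducible f v e : ModPlus R f -> fwd v -> f *m v = v ->
  dot e e = -1 -> dot v e = 0 -> reducible f.
Proof.
move=> hf fv fvv ee ve.
have [s hs dg] := descent R hn (L := vroots n) (fun v h => h) fv.
move: dg; set g := \prod_(w <- s) refl w => dg.
have hg : ModPlus R g by apply: prod_ModPlus.
have ig := ModPlus_isom hg; have iff := ModPlus_isom hf.
apply: (reducible_conj ig).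
have fg : fwd (g *m v) by exact: ModPlus_fwd hg fv.
apply: (dominant_fixed_reducible (v := g *m v)) => //.
- by apply: isomM; [exact: isomM | exact: isom_adj].
- by rewrite -(mulmxA (g *m f)) (mulmxA (adj g)) adjl // mul1mx -mulmxA fvv.
have ee' : dot (g *m e) (g *m e) = -1 by rewrite isom_dot.
have ve' : dot (g *m v) (g *m e) = 0 by rewrite isom_dot.
have [_ h1 h2 h3 [h4 h5 h6 h7 h8]] := vroots_nef hn dg.
have H i : (0 < i <= n)%N -> mc (g *m v) i = 0 -> mc (g *m v) n = 0.
  have [dg' h0] := proj1 (vroots_dominant hn _) dg.
  have [_ hi] := dominant_simple hn dg'.
  move=> /andP[i0 ile] mi; apply/eqP; rewrite eq_le h0 andbT -mi.
  have mono k : (k <= n - i)%N -> mc (g *m v) (k + i) <= mc (g *m v) i.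
    elim: k => [|k ih] hk //.
    by have := ih ltac:(lia); rewrite addSn; apply: le_trans; apply: hi; lia.
  by have := mono _ (leqnn _); rewrite subnK.
case: (orth_class hn fg dg ee' ve') => [[i [hi mi _]]|[m3 _ _ _]]; first exact: H mi.
by apply: (H 3%N) => //; lia.
Qed.

End Red.

(** * Fixed vectors of irreducible classes *)

Section Fixed.
Variables (R : realType) (n : nat).
Hypothesis (hn : (3 <= n <= 8)%N).
Implicit Types (x y u v e : 'cV[int]_n.+1) (f g : 'M[int]_n.+1).

Let n3 : (3 <= n)%N. Proof. by case/andP: hn. Qed.
Let n8 : (n <= 8)%N. Proof. by case/andP: hn. Qed.

Lemma dotK8 x : dot x (- Kcl n) = 3 * mc x 0 - (mc x 1 + mc x 2 + mc x 3 + mc x 4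
  + mc x 5 + mc x 6 + mc x 7 + mc x 8).
Proof.
have e i : (0 < i)%N -> mc x i * mc (- Kcl n) i = mc x i.
  rewrite mcN mcK; case: i => // i _ /=; case: ltnP => h; first by rewrite opprK mulr1.
  by rewrite mc_big // mul0r.
have k0 : mc (- Kcl n) 0 = 3 by rewrite mcN mcK.
by rewrite dot_mc // k0 (e 1) ?(e 2) ?(e 3) ?(e 4) ?(e 5) ?(e 6) ?(e 7) ?(e 8) // mulrC.
Qed.

Definition characteristic u := forall x, exists k, dot u x - dot x x = 2 * k.

Lemma characteristicK : characteristic (- Kcl n).
Proof.
move=> x; rewrite dotC dotK8 dot_mc //.
have P (z : int) : exists k, z * z = z + 2 * k.
  have zE := divz_eq z 2; set q := (z %/ 2)%Z in zE; set r := (z %% 2)%Z in zE.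
  have [r0|r1] : r = 0 \/ r = 1.
    by have := modz_ge0 z (isT : 2 != 0 :> int); have := ltz_pmod z (isT : 0 < 2 :> int); lia.
  - by exists (2 * q * q - q); rewrite zE r0; ring.
  by exists (2 * q * q + q); rewrite zE r1; ring.
have [k0 ->] := P (mc x 0); have [k1 ->] := P (mc x 1); have [k2 ->] := P (mc x 2).
have [k3 ->] := P (mc x 3); have [k4 ->] := P (mc x 4); have [k5 ->] := P (mc x 5).
have [k6 ->] := P (mc x 6); have [k7 ->] := P (mc x 7); have [k8 ->] := P (mc x 8).
by exists (mc x 0 - k0 + (k1 + k2 + k3 + k4 + k5 + k6 + k7 + k8)); lia.
Qed.

Lemma characteristic_isom f u : isomQ f -> characteristic u -> characteristic (f *m u).
Proof.
move=> hf hu x; have [k hk] := hu (adj f *m x); exists k; rewrite -hk.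
by rewrite dot_adj // (isom_dot _ _ (isom_adj hf)).
Qed.

Lemma simple_orthK v : v \in simple_roots n -> dot (Kcl n) v = 0.
Proof. by move=> /(simple_rootP n3)[]. Qed.

Lemma nef_eq0 x : nef_class x ->
  mc x 0 = 0 -> x = 0.
Proof.
case=> h0 h1 h2 h3 [h4 h5 h6 h7 h8] x0; apply: mc_inj => i hi.
rewrite -[in RHS](scale0r 0) mcZ mul0r; move: (leq_trans hi n8).
by case: i hi => [|[|[|[|[|[|[|[|[|i]]]]]]]]] // _ _; lia.
Qed.

(* In the chamber [u + K] is nef, hence [u ^ 2 >= K ^ 2 + (u + K) ^ 2]; outside it,
   reflecting [u] into the chamber does not raise [u . v]. *)
Lemma characteristic_min v : dominant (vroots n) v -> 0 < mc v n ->
  forall u, fwd u -> characteristic u -> dot u u = 9 - n%:Z ->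
  dot (- Kcl n) v <= dot u v /\ (dot u v = dot (- Kcl n) v -> u = - Kcl n).
Proof.
move=> dv vn; apply: (descent_ind R hn (L := vroots n)) => // [u fu du hu uu|u a fu ha ua ih hu uu].
  suff -> : u = - Kcl n by [].
  have [du' un] := proj1 (vroots_dominant hn u) du.
  have [D De] : exists D, D = u + Kcl n by eexists.
  have uE : u = D - Kcl n by rewrite De addrK.
  have mD i : (0 < i <= n)%N -> mc D i = mc u i - 1.
    by move=> hi; rewrite De mcD mcK; case: i hi => // i /andP[_ ->].
  have nD : nef_class D.
    apply: simple_nef => //.
      apply/allP => w hw; rewrite De dotDl simple_orthK // addr0; exact: (allP du').
    rewrite mD; last by lia.
    (* As [u] is characteristic, u . E_n is odd; being nonnegative, it is at least 1. *)
    have [k] := hu (Ecl n n); rewrite -mcE ?dotEE ?eqxx; lia.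
  have D2 := nef_sq nD; have DK := nef_K nD.
  have KK : dot (- Kcl n) (- Kcl n) = 9 - n%:Z by rewrite dotNl dotNr opprK dotKK.
  move: uu; rewrite {1 2}uE dotDl !dotDr KK (dotC (- Kcl n) D) dotK8 dot_mc // => uu.
  have := sqr_ge0 (mc D 2) => D2'.
  have [h0 h1 h2 h3 [h4 h5 h6 h7 h8]] := nD.
  (* The equation [uu] says D^2 + 2 D . (- K) = 0 with both terms nonnegative. So D . (- K) = 0,
     which by [DK] bounds m_1 by 0 and leaves d = 0. *)
  suff : D = 0 by move=> D0; rewrite uE D0 add0r.
  by apply: nef_eq0 => //; lia.
have ha' := vroot_isom hn ha.
have [||h1 h2] := ih; first exact: characteristic_isom.
  by rewrite isom_dot.
have va : 0 <= dot v a by exact: (allP dv).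
have le := dot_refl_le hn ha ua va.
split; first exact: le_trans h1 le.
move=> e; have ruv : dot (refl a *m u) v = dot (- Kcl n) v by apply/eqP; rewrite eq_le h1 andbT -e.
have ru := h2 ruv.
have [va0|va0] : 0 < dot v a \/ dot v a = 0 by lia.
  by have := dot_refl_lt hn ha ua va0; rewrite ruv e ltxx.
(* The case v . a = 0: [a] is not E_n because m_n > 0, so it is orthogonal to K. But - K is the
   reflection of [u] in [a], and u . a < 0. *)
move: ha; rewrite mem_rcons inE => /orP[/eqP ae|has]; first by move: va0; rewrite ae -mcE; lia.
have [aa Ka] := simple_rootP n3 has.
by move: (dot_refl u a a); rewrite ru dotNl Ka aa (_ : (2 %/ -2)%Z = -1) //; lia.
Qed.

Lemma dominant_fixed_fixK f v : ModPlus R f -> f *m v = v -> fwd v -> dominant (vroots n) v ->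
  0 < mc v n -> f *m Kcl n = Kcl n.
Proof.
move=> hf fvv fv dv vn; have iff := ModPlus_isom hf.
apply: oppr_inj; rewrite -mulmxN.
have [||_] := characteristic_min dv vn (ModPlus_fwd hf (fwdK hn)).
- by apply: characteristic_isom => //; exact: characteristicK.
- by rewrite isom_dot // dotNl dotNr opprK dotKK.
by apply; rewrite -{1}fvv isom_dot.
Qed.

(** * Orbit sums and fixed conic classes *)

Section Orbit.
Variables (p : nat) (f : 'M[int]_n.+1).
Hypotheses (fp : f ^+ p = 1) (iff : isomQ f).

Definition orbit_sum x := \sum_(i < p) (f ^+ i) *m x.

Lemma orbit_sum_fixed x : f *m orbit_sum x = orbit_sum x.
Proof.
rewrite /orbit_sum mulmx_sumr; case: (posnP p) => p0.
  by move: fp; rewrite p0 => _; rewrite !big_ord0.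
rewrite -(prednK p0) big_ord_recr [RHS]big_ord_recl /= addrC; congr (_ + _).
  by rewrite mulmxA -[f *m f ^+ _]/(f * f ^+ _) -exprS prednK // fp expr0.
by apply: eq_bigr => i _; rewrite mulmxA -[f *m f ^+ _]/(f * f ^+ _) -exprS.
Qed.

Lemma dot_orbit_sum v x : f *m v = v -> dot v (orbit_sum x) = p%:Z * dot v x.
Proof.
move=> fv; rewrite /orbit_sum dot_sumr (eq_bigr (fun=> dot v x)); last first.
  move=> i _; have {1}-> : v = f ^+ i *m v.
    by elim: (i : nat) => [|k ih]; [rewrite expr0 mul1mx | rewrite exprSr -mulmxA fv].
  by rewrite isom_dot //; exact: isomX.
by rewrite sumr_const card_ord -mulr_natl natz.
Qed.

(** The combination v = - q u + (u . e) s of the fixed vectors u = - K and s is orthogonal to [e],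
    and q < 0 makes it forward, so [fixed_orth_reducible] applies. *)
Lemma orbit_reducible e : (0 < p)%N -> f *m Kcl n = Kcl n -> dot e e = -1 ->
  dot e (orbit_sum e) < 0 -> reducible f.
Proof.
move=> p0 fK ee; set s := orbit_sum e; set q := dot e s => q0.
pose u := - Kcl n; have fu : f *m u = u by rewrite mulmxN fK.
have uu : 0 < dot u u by have [] := fwdK hn.
have us : dot u s = p%:Z * dot u e by exact: dot_orbit_sum.
have ss : dot s s = p%:Z * q by rewrite dot_orbit_sum ?orbit_sum_fixed // dotC.
pose v := - q *: u + dot u e *: s.
have ve : dot v e = 0 by rewrite dotDl !dotZl (dotC s) -/q; ring.
have fv : f *m v = v by rewrite mulmxDr -!scalemxAr fu orbit_sum_fixed.
have uv : dot u v = - q * dot u u + p%:Z * (dot u e) ^+ 2 by rewrite dotDr !dotZr us; ring.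
have vv : dot v v = q ^+ 2 * dot u u - p%:Z * q * (dot u e) ^+ 2.
  by rewrite {1}/v dotDl !dotZl uv dotDr !dotZr (dotC s u) us ss; ring.
have sq := sqr_ge0 (dot u e).
apply: (@fixed_orth_reducible R n hn f v e) => //; first exact: (isom_fwd R iff (fwdK hn)).
have qu : 0 < - q * dot u u by rewrite mulr_gt0 ?oppr_gt0.
have pe : 0 <= p%:Z * dot u e ^+ 2 by rewrite mulr_ge0.
apply: (dot_fwd (fwdK hn)); last by rewrite -/u uv ltr_wpDr.
rewrite vv (_ : _ - _ = - q * (- q * dot u u + p%:Z * dot u e ^+ 2)); last by ring.
by rewrite mulr_gt0 ?oppr_gt0 // ltr_wpDr.
Qed.

(* [f] permutes the components [E_i] and [H - E_1 - E_i] of the singular fibres of the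
   conic bundle [H - E_1], and no power exchanges the two components of a fibre. *)
Lemma fibre_reducible : odd p -> f *m Kcl n = Kcl n ->
  f *m (Hcl n - Ecl n 1) = Hcl n - Ecl n 1 -> reducible f.
Proof.
move=> podd fK; set c := Hcl n - Ecl n 1 => fc; pose e := Ecl n 2.
have h2 : (0 < 2 <= n)%N by lia.
have h1 : (0 < 1 <= n)%N by lia.
have ee : dot e e = -1 by rewrite dotEE.
have ec : dot c e = 0 by rewrite dotBl (dotC (Hcl n)) dotH mcEcl // dotEE //= subrr.
have fXc i : f ^+ i *m c = c.
  by elim: i => [|i ih]; [rewrite expr0 mul1mx | rewrite exprSr -mulmxA fc].
have fXK i : f ^+ i *m Kcl n = Kcl n.
  by elim: i => [|i ih]; [rewrite expr0 mul1mx | rewrite exprSr -mulmxA fK].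
have le i : dot e (f ^+ i *m e) <= 0.
  set x := f ^+ i *m e.
  have iX := isomX i iff.
  have xx : dot x x = -1 by rewrite isom_dot.
  have cx : mc x 0 = mc x 1.
    have : dot x c = 0 by rewrite dotC -(fXc i) isom_dot.
    by rewrite dotBr dotH -mcE // => /eqP; rewrite subr_eq0 => /eqP.
  have Kx : dot x (- Kcl n) = 1.
    by rewrite -{1}(fXK i) -mulmxN isom_dot // dotNr dotC dotKE ?opprK.
  move: xx Kx; rewrite dot_mc // dotK8 -cx dotC -mcE // => xx Kx.
  rewrite leNgt; apply/negP => x2.
  have P (b : int) : 0 <= b * b by rewrite -expr2 sqr_ge0.
  have Z (b : int) : b * b <= 0 -> b = 0 by nia.
  (* As mc x 0 = mc x 1, the equation x . x = -1 leaves m_2^2 + ... + m_8^2 = 1; with m_2 > 0 and x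
     . (- K) = 1 only x = H - E_1 - E_2 remains. *)
  have x22 : mc x 2 <= mc x 2 * mc x 2 by nia.
  have e2 : mc x 2 = 1.
    by move: (P (mc x 3)) (P (mc x 4)) (P (mc x 5)) (P (mc x 6)) (P (mc x 7)) (P (mc x 8)); lia.
  move: (P (mc x 3)) (P (mc x 4)) (P (mc x 5)) (P (mc x 6)) (P (mc x 7)) (P (mc x 8)).
  rewrite e2 in xx Kx => *.
  have e3 : mc x 3 = 0 by apply: Z; lia.
  have e4 : mc x 4 = 0 by apply: Z; lia.
  have e5 : mc x 5 = 0 by apply: Z; lia.
  have e6 : mc x 6 = 0 by apply: Z; lia.
  have e7 : mc x 7 = 0 by apply: Z; lia.
  have e8 : mc x 8 = 0 by apply: Z; lia.
  have e0 : mc x 0 = 1 by lia.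
  have xE : x = c - e.
    apply: mc_inj => j hj; rewrite /c /e !mcB mcH !mcEcl //.
    move: (leq_trans hj n8).
    by case: j hj => [|[|[|[|[|[|[|[|[|j]]]]]]]]] // _ _; rewrite -?cx ?e0 ?e2 ?e3 ?e4 ?e5 ?e6 ?e7 ?e8.
  have x2E : f ^+ i *m x = e by rewrite xE mulmxBr fXc -/x xE subKr.
  (* [f ^+ i] exchanges [e] and [c - e], hence so does its odd power [f ^+ (i * p)], which is 1. *)
  have ev k : f ^+ (i * k.*2) *m e = e.
    elim: k => [|k ih]; first by rewrite muln0 expr0 mul1mx.
    rewrite doubleS -addn2 mulnDr exprD mulnS muln1 exprD.
    by rewrite -[X in X *m e]/(_ *m (_ *m _)) -!mulmxA -/x x2E.
  have : f ^+ (i * p) *m e = x.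
    rewrite -(odd_double_half p) podd mulnDr muln1 exprD -[X in X *m e]/(_ *m _).
    by rewrite -mulmxA ev.
  rewrite mulnC exprM fp expr1n mul1mx => ex.
  by move: e2; rewrite -ex mcEcl.
apply: (@orbit_reducible e) => //; first by case: (p) podd.
rewrite /orbit_sum dot_sumr; case: p podd => // k _.
rewrite big_ord_recl expr0 mul1mx ee; apply: (@le_lt_trans _ _ (-1)) => //.
rewrite -[leRHS]addr0 lerD2l; apply: sumr_le0 => i _; exact: le.
Qed.

End Orbit.
End Fixed.

(** * Irreducible classes: conjugation to f K = K and vanishing of fixed vectors in K^perp *)

Section Reduction.
Variables (R : realType) (n : nat).
Hypothesis (hn : (3 <= n <= 8)%N).
Implicit Types (x y u v e : 'cV[int]_n.+1) (f g : 'M[int]_n.+1).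

Let n3 : (3 <= n)%N. Proof. by case/andP: hn. Qed.
Let n8 : (n <= 8)%N. Proof. by case/andP: hn. Qed.

Lemma conjX f g k : isomQ g -> (g *m f *m adj g) ^+ k = g *m f ^+ k *m adj g.
Proof.
move=> hg; elim: k => [|k ih]; first by rewrite !expr0 mulmx1 adjr.
rewrite !exprS ih -[LHS]/(_ *m _) -[f * _]/(f *m _).
by rewrite -(mulmxA g (f ^+ k)) (mulmxA _ g) -(mulmxA (g *m f)) adjl // mulmx1 !mulmxA.
Qed.

Lemma fixed_H_minus_E1 y : dominant (simple_roots n) y -> mc y n = 0 -> dot y y <= 0 ->
  y = mc y 0 *: (Hcl n - Ecl n 1).
Proof.
move=> dy yn yy; have ny : nef_class y.
  by apply: simple_nef => //; rewrite yn.
have := nef_sq ny; rewrite -dot_mc // => y2.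
have [h0 h1 h2 h3 [h4 h5 h6 h7 h8]] := ny.
have m2 : mc y 2 = 0.
  by apply/eqP; rewrite -sqrf_eq0 eq_le sqr_ge0 andbT; apply: le_trans y2 yy.
have m3 : mc y 3 = 0 by lia.
have m4 : mc y 4 = 0 by lia.
have m5 : mc y 5 = 0 by lia.
have m6 : mc y 6 = 0 by lia.
have m7 : mc y 7 = 0 by lia.
have m8 : mc y 8 = 0 by lia.
have e01 : mc y 0 = mc y 1.
  move: yy; rewrite dot_mc // m2 m3 m4 m5 m6 m7 m8 !mulr0 !addr0 => yy.
  apply/eqP; rewrite eq_le; apply/andP; split; last by lia.
  rewrite leNgt; apply/negP => lt.
  have : 0 < (mc y 0 - mc y 1) * (mc y 0 + mc y 1) by rewrite mulr_gt0 ?subr_gt0 //; lia.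
  lia.
apply: mc_inj => i hi; rewrite mcZ mcB mcH mcEcl //; last by lia.
move: (leq_trans hi n8).
by case: i hi => [|[|[|[|[|[|[|[|[|i]]]]]]]]] // _ _; rewrite -?e01 ?m2 ?m3 ?m4 ?m5 ?m6 ?m7 ?m8 /=; lia.
Qed.

Lemma irreducible_fixed p f x : odd p -> f ^+ p = 1 -> isomQ f -> f *m Kcl n = Kcl n ->
  irreducible f -> f *m x = x -> dot (Kcl n) x = 0 -> x = 0.
Proof.
move=> podd fp hf fK irr fx Kx; apply: contra_not_eq irr => x0.
(* This N makes u^2 = N^2 K^2 + x^2 positive, so that the descent can be applied to [u]. *)
pose N : int := 1 + `|dot x x|; pose u := N *: - Kcl n + x.
have KK : 0 < dot (- Kcl n) (- Kcl n) by have [] := fwdK hn.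
have fu : fwd u.
  have Ku : dot (- Kcl n) x = 0 by rewrite dotNl Kx oppr0.
  have uK : dot (- Kcl n) u = N * dot (- Kcl n) (- Kcl n) by rewrite dotDr dotZr Ku addr0.
  apply: (dot_fwd (fwdK hn)); last by rewrite uK mulr_gt0 //; lia.
  rewrite {1}/u dotDl dotZl uK dotDr dotZr (dotC x) Ku mulr0 add0r.
  have N1 : 1 <= N by lia.
  have : N * 1 <= N * (N * dot (- Kcl n) (- Kcl n)) by apply: ler_pM => //; nia.
  lia.
(* Only reflections of W_n are used here, so that [g] fixes K. *)
have [s hs ds] := descent R hn (L := simple_roots n) (@vroot_sub n) fu.
move: ds; set g := \prod_(w <- s) refl w => dg.
have hg : ModPlus R g by apply: prod_ModPlus => // w /hs/vroot_sub.
have ig := ModPlus_isom hg.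
have gK : g *m Kcl n = Kcl n by exact: prod_fixK.
apply: (reducible_conj ig); set f' := g *m f *m adj g.
have if' : isomQ f' by apply: isomM; [exact: isomM|exact: isom_adj].
have f'p : f' ^+ p = 1 by rewrite conjX // fp mulmx1 adjr.
have f'g z : f' *m (g *m z) = g *m (f *m z).
  by rewrite /f' -(mulmxA (g *m f)) (mulmxA (adj g)) adjl // mul1mx mulmxA.
have f'K : f' *m Kcl n = Kcl n by rewrite -{1}gK f'g fK.
have f'x : f' *m (g *m x) = g *m x by rewrite f'g fx.
(* K is orthogonal to the simple roots, so moving along it changes m_n but keeps the other chamber
   inequalities. *)
pose y := g *m x - mc (g *m x) n *: - Kcl n.
have f'y : f' *m y = y by rewrite mulmxBr f'x -scalemxAr mulmxN f'K.
have dy : dominant (simple_roots n) y.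
  apply/allP => w hw; have := allP dg w hw; rewrite /= /u mulmxDr -scalemxAr mulmxN gK.
  have Kw : dot (- Kcl n) w = 0 by rewrite dotNl simple_orthK ?oppr0.
  by rewrite dotDl dotZl Kw mulr0 add0r dotBl dotZl Kw mulr0 subr0.
have yn : mc y n = 0.
  rewrite mcB mcZ mcN mcK (_ : n == 0%N = false); last by lia.
  by rewrite leqnn opprK mulr1 subrr.
have y0 : y != 0.
  apply: contra_neq x0; rewrite /y => /eqP; rewrite subr_eq0 => /eqP e.
  have : dot (- Kcl n) (g *m x) = 0.
    by rewrite -gK -mulmxN isom_dot // dotNl Kx oppr0.
  rewrite e dotZr => /eqP; rewrite mulf_eq0 (gt_eqF KK) orbF => /eqP a0.
  by move: e; rewrite a0 scale0r => e; rewrite -[x]mul1mx -(adjl ig) -mulmxA e mulmx0.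
have ny : nef_class y.
  by apply: simple_nef => //; rewrite yn.
have d0 : 0 < mc y 0.
  rewrite lt0r; apply/andP; split; last by have [h0 h1 h2 h3 [h4 h5 h6 h7 h8]] := ny; lia.
  by apply: contra_neq y0; apply: nef_eq0.
have [yy|yy] := ltrP 0 (dot y y).
  have dy' : dominant (vroots n) y by apply/vroots_dominant => //; rewrite yn.
  exact: (dominant_fixed_reducible hn if' _ dy' f'y yn).
apply: (fibre_reducible R hn f'p if' podd f'K).
have yE := fixed_H_minus_E1 dy yn yy.
have cancel (a b : 'cV[int]_n.+1) : mc y 0 *: a = mc y 0 *: b -> a = b.
  move=> /matrixP e; apply/matrixP => i j; have := e i j.
  by rewrite !mxE => /(mulfI (lt0r_neq0 d0)).
by apply: cancel; rewrite scalemxAr -yE.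
Qed.

(** The difference of the two sides is fixed by [f] and orthogonal to K. *)
Lemma irreducible_orbit_sum p f x : odd p -> f ^+ p = 1 -> isomQ f -> f *m Kcl n = Kcl n ->
  irreducible f -> (9 - n%:Z) *: orbit_sum p f x = (p%:Z * dot (Kcl n) x) *: Kcl n.
Proof.
move=> podd fp hf fK irr; apply/eqP; rewrite -subr_eq0; apply/eqP.
apply: (irreducible_fixed podd fp hf fK irr).
  by rewrite mulmxBr -!scalemxAr fK orbit_sum_fixed.
by rewrite dotBr !dotZr dotKK // dot_orbit_sum //; ring.
Qed.

(** In [irreducible_orbit_sum] for x = E_1, the coefficient of E_1 on the right is p, and on the
    left a multiple of 9 - n. *)
Lemma irreducible_degree p f : odd p -> f ^+ p = 1 -> isomQ f -> f *m Kcl n = Kcl n ->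
  irreducible f -> (9 - n %| p)%N.
Proof.
move=> podd fp hf fK irr.
have := congr1 (fun z => mc z 1) (irreducible_orbit_sum (Ecl n 1) podd fp hf fK irr).
rewrite /= !mcZ dotKE; last by lia.
rewrite mcK /= (_ : (0 < n)%N = true); last by lia.
rewrite !mulrN1 opprK => e.
suff : ((9 - n)%:Z %| p%:Z)%Z by [].
by apply/dvdzP; exists (mc (orbit_sum p f (Ecl n 1)) 1); rewrite -e mulrC; congr (_ * _); lia.
Qed.

Lemma irreducible_conj p f : ModPlus R f -> irreducible f -> (0 < p)%N -> f ^+ p = 1 ->
  exists2 g, ModPlus R g & (g *m f *m adj g) *m Kcl n = Kcl n.
Proof.
move=> hf irr p0 fp; have iff := ModPlus_isom hf.
pose v := orbit_sum p f (Hcl n).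
have fv : fwd v.
  rewrite /v /orbit_sum; case: (p) p0 => // k _; rewrite big_ord_recr /=.
  have fi i : fwd (f ^+ i *m Hcl n) by exact: (ModPlus_fwd (ModPlusX i hf) (fwdH n)).
  elim: k => [|k ih]; first by rewrite big_ord0 add0r.
  by rewrite big_ord_recr /=; apply: fwdD.
have fvv : f *m v = v by apply: orbit_sum_fixed.
have [s hs ds] := descent R hn (L := vroots n) (fun v h => h) fv.
move: ds; set g := \prod_(w <- s) refl w => dg.
have hg : ModPlus R g by apply: prod_ModPlus.
have ig := ModPlus_isom hg; exists g => //.
set f' := g *m f *m adj g.
have hf' : ModPlus R f' by apply: ModPlusM; [exact: ModPlusM|exact: ModPlus_adj].
have f'v : f' *m (g *m v) = g *m v.
  by rewrite /f' -(mulmxA (g *m f)) (mulmxA (adj g)) adjl // mul1mx -mulmxA fvv.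
have fgv := ModPlus_fwd hg fv.
have [_ h] := proj1 (vroots_dominant hn _) dg.
apply: (dominant_fixed_fixK hn hf' f'v fgv dg).
rewrite lt0r h andbT; apply/eqP => vn; apply: irr.
apply: (reducible_conj ig).
exact: (dominant_fixed_reducible hn (ModPlus_isom hf') fgv dg f'v vn).
Qed.

End Reduction.

(** * Fixed points modulo primes *)

Lemma fixed_points_mod (T : finType) (s : {perm T}) (p : nat) : prime p ->
  (s ^+ p = 1)%g -> #|T| = #|[set x | s x == x]| %[mod p].
Proof.
move=> pp sp; pose G : {group {perm T}} := <[s]>%G.
have pG : (p.-group G)%g.
  apply: (@pnat_dvd _ p); last by rewrite pnat_id.
  by rewrite -[#|G|]/#[s]%g order_dvdn sp.
have aG : [acts G, on [set: T] | 'P]%g by apply/actsP => a _ x; rewrite !inE.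
have := pgroup_fix_mod pG aG; rewrite cardsT => ->; congr (#|pred_of_set _| %% _)%N.
apply/setP => x; rewrite setTI [RHS]inE; apply/afixP/eqP => [h|h a]; first exact: (h s (cycle_id s)).
case/cycleP => i ->; elim: i => [|i ih]; first by rewrite expg0; apply: act1.
by rewrite expgSr; apply: etrans (actMin 'P _ _ _) _; rewrite ?inE //= ih.
Qed.

(** Modulo q, a fixed vector X satisfies p X = p l(X) k with p invertible, so the fixed vectors form
    the line of [k], with q elements. A permutation of the q^(n+1) vectors whose p-th power is 1 has
    as many fixed points modulo p as there are vectors. *)
Lemma fixed_line_mod (n p q : nat) (f : 'M[int]_n.+1) (k : 'cV[int]_n.+1) (l : 'cV[int]_n.+1 -> int) :
  prime p -> prime q -> p != q -> f ^+ p = 1 -> f *m k = k ->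
  (exists i, k i ord0 = 1) ->
  (forall x, orbit_sum p f x = (p%:Z * l x) *: k) -> q ^ n.+1 = q %[mod p].
Proof.
move=> pp pq pnq fp fk [i0 ki0] hs.
pose F : 'M['F_q]_n.+1 := map_mx intr f.
pose k' : 'cV['F_q]_n.+1 := map_mx intr k.
have FX j : map_mx intr (f ^+ j) = F ^+ j.
  elim: j => [|j ih]; first by rewrite !expr0 map_mx1.
  by rewrite !exprS -[f * _]/(f *m _) map_mxM ih.
have Fp : F ^+ p = 1 by rewrite -FX fp map_mx1.
have Finj : injective (fun x : 'cV['F_q]_n.+1 => F *m x).
  move=> x y e; rewrite -[x]mul1mx -[y]mul1mx -[1%:M]/(1 : 'M_n.+1) -Fp.
  by rewrite -(prednK (prime_gt0 pp)) exprSr -[F ^+ _ * F]/(_ *m _) -!mulmxA e.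
pose s := perm Finj.
have sX j x : (s ^+ j)%g x = F ^+ j *m x.
  elim: j x => [|j ih] x; first by rewrite expg0 perm1 expr0 mul1mx.
  by rewrite expgSr permM permE ih exprS mulmxA.
have sp : (s ^+ p = 1)%g by apply/permP => x; rewrite sX Fp perm1 mul1mx.
have := fixed_points_mod pp sp.
have k'i : k' i0 ord0 = 1 by rewrite mxE ki0.
have k'F : F *m k' = k' by rewrite -map_mxM fk.
have -> : [set x | s x == x] = [set t *: k' | t : 'F_q].
  apply/setP => X; rewrite !inE permE; apply/eqP/imsetP; last first.
    by case=> t _ ->; rewrite -scalemxAr k'F.
  move=> fixX; pose x : 'cV[int]_n.+1 := \col_i (X i ord0 : nat)%:Z.
  have xX : map_mx intr x = X by apply/matrixP => i j; rewrite !mxE (ord1 j) -pmulrn natr_Zp.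
  have := congr1 (map_mx (intr : int -> 'F_q)) (hs x).
  rewrite /orbit_sum map_mx_sum map_mxZ -/k'.
  rewrite -[X in X *: _]/((p%:Z * l x)%:~R) intrM (eq_bigr (fun=> X)); last first.
    move=> i _; rewrite map_mxM xX FX.
    by elim: (i : nat) => [|j ih]; [rewrite expr0 mul1mx | rewrite exprSr -mulmxA fixX].
  rewrite sumr_const card_ord -scaler_nat -scalerA.
  have p0 : p%:R != 0 :> 'F_q.
    by rewrite -(dvdn_pcharf (pchar_Fp pq)) dvdn_prime2 // eq_sym.
  by move/(scalerI p0) => ->; exists (l x)%:~R.
rewrite card_imset ?card_Fp //; last first.
  by move=> t t' /(congr1 (fun M : 'cV_n.+1 => M i0 ord0)); rewrite !mxE -/k' ki0 !mulr1.
by rewrite card_mx card_Fp // muln1.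
Qed.

Section Degree1.
Variables (R : realType).

Lemma irreducible_order8 p (f : 'M[int]_9) : prime p -> odd p -> f ^+ p = 1 -> isomQ f ->
  f *m Kcl 8 = Kcl 8 -> irreducible f -> p = 3%N \/ p = 5%N.
Proof.
move=> pp podd fp hf fK irr.
have hk : exists i, Kcl 8 i ord0 = 1 by exists (inord 1); rewrite KclE.
have hs x : orbit_sum p f x = (p%:Z * dot (Kcl 8) x) *: Kcl 8.
  by rewrite -[LHS]scale1r -(irreducible_orbit_sum R (n := 8) isT x podd fp hf fK irr).
have H q : prime q -> p != q -> q ^ 9 = q %[mod p].
  by move=> pq pnq; exact: (fixed_line_mod pp pq pnq fp fK hk hs).
have [->|p3] := eqVneq p 3%N; first by left.
right.
have p2 : p != 2%N by apply: contraTneq podd => ->.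
have /eqP := H 2%N isT p2; rewrite eqn_mod_dvd // => d2.
have /eqP := H 3%N isT p3; rewrite eqn_mod_dvd // => d3.
(* The factorizations are 2^9 - 2 = 2 . 3 . 5 . 17 and 3^9 - 3 = 2^5 . 3 . 5 . 41. *)
have : (p %| gcdn (2 ^ 9 - 2) (3 ^ 9 - 3))%N by rewrite dvdn_gcd d2 d3.
rewrite (_ : gcdn _ _ = 2 * 3 * 5)%N // !Euclid_dvdM // !dvdn_prime2 //.
by rewrite (negbTE p2) (negbTE p3) => /eqP.
Qed.

End Degree1.

(** * Conjugation to powers of a Coxeter element *)

Section Transfer.
Variables (n m p : nat).
Implicit Types (f g h : 'M[int]_n.+1) (v w : nat -> 'cV[int]_n.+1) (x y : 'cV[int]_n.+1).

(** K followed by the orbits one after another: index a p + d + 1 is f^d v_a, for d < p. *)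
Definition orbit_family f v (j : nat) : 'cV[int]_n.+1 :=
  if j is i.+1 then f ^+ (i %% p) *m v (i %/ p)%N else Kcl n.

Lemma expfix f k x : f *m x = x -> f ^+ k *m x = x.
Proof.
by move=> fx; elim: k => [|k ih]; [rewrite expr0 mul1mx | rewrite exprSr -mulmxA fx].
Qed.

Lemma dot_pow f i j x y : isomQ f -> (i <= j)%N ->
  dot (f ^+ i *m x) (f ^+ j *m y) = dot x (f ^+ (j - i) *m y).
Proof.
move=> hf ij; have -> : f ^+ j *m y = f ^+ i *m (f ^+ (j - i) *m y).
  by rewrite mulmxA -[f ^+ i *m _]/(f ^+ i * _) -exprD subnKC.
by rewrite isom_dot //; apply: isomX.
Qed.

Lemma orbit_family_gram f g v w : (0 < p)%N -> isomQ f -> isomQ g ->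
  f *m Kcl n = Kcl n -> g *m Kcl n = Kcl n ->
  (forall a, (a < m)%N -> dot (Kcl n) (v a) = dot (Kcl n) (w a)) ->
  (forall a b d, (a < m)%N -> (b < m)%N -> (d < p)%N ->
    dot (v a) (f ^+ d *m v b) = dot (w a) (g ^+ d *m w b)) ->
  forall i j, (i < (m * p).+1)%N -> (j < (m * p).+1)%N ->
  dot (orbit_family f v i) (orbit_family f v j) = dot (orbit_family g w i) (orbit_family g w j).
Proof.
move=> p0 hf hg fK gK hK hd.
have lt i : (i < m * p)%N -> (i %/ p < m)%N by rewrite ltn_divLR.
have HK i : (i < m * p)%N -> dot (Kcl n) (f ^+ (i %% p) *m v (i %/ p)%N)
    = dot (Kcl n) (g ^+ (i %% p) *m w (i %/ p)%N).
  move=> hi; rewrite -{1}(expfix (i %% p) fK) -{2}(expfix (i %% p) gK).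
  by rewrite (isom_dot _ _ (isomX _ hf)) (isom_dot _ _ (isomX _ hg)); exact: hK (lt _ hi).
have H i j : (i < m * p)%N -> (j < m * p)%N -> (i %% p <= j %% p)%N ->
    dot (f ^+ (i %% p) *m v (i %/ p)%N) (f ^+ (j %% p) *m v (j %/ p)%N)
    = dot (g ^+ (i %% p) *m w (i %/ p)%N) (g ^+ (j %% p) *m w (j %/ p)%N).
  move=> hi hj le; rewrite !dot_pow // hd ?lt //.
  by rewrite (leq_ltn_trans (leq_subr _ _)) // ltn_mod.
case=> [|i] [|j] //=; rewrite ?ltnS => hi hj; first exact: HK.
  by rewrite ![dot _ (Kcl n)]dotC; apply: HK.
have [le|/ltnW le] := leqP (i %% p) (j %% p); first exact: H.
by rewrite dotC [RHS]dotC; apply: H.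
Qed.

(** The families may be linearly dependent, so [h] is defined on the standard basis through the
    coefficients [c]. Equal Gram matrices make it an isometry; nondegeneracy then shows that it
    carries each member of the family of [g] to that of [f], and so intertwines the two actions. *)
Lemma transfer f g v w (c : nat -> nat -> int) : (0 < p)%N ->
  isomQ f -> isomQ g -> f *m Kcl n = Kcl n -> g *m Kcl n = Kcl n ->
  (forall a, (a < m)%N -> f ^+ p *m v a = v a) ->
  (forall a, (a < m)%N -> g ^+ p *m w a = w a) ->
  (forall a, (a < m)%N -> dot (Kcl n) (v a) = dot (Kcl n) (w a)) ->
  (forall a b d, (a < m)%N -> (b < m)%N -> (d < p)%N ->
    dot (v a) (f ^+ d *m v b) = dot (w a) (g ^+ d *m w b)) ->
  (forall t : 'I_n.+1, delta_mx t ord0 = \sum_(j < (m * p).+1) c t j *: orbit_family g w j) ->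
  exists h, [/\ isomQ h, h *m Kcl n = Kcl n & f *m h = h *m g].
Proof.
move=> p0 hf hg fK gK fv gw hK hd hc.
have G := orbit_family_gram p0 hf hg fK gK hK hd.
pose dl t : 'cV[int]_n.+1 := delta_mx t ord0.
pose h : 'M[int]_n.+1 := \matrix_(i, t) (\sum_(j < (m * p).+1) c t j *: orbit_family f v j) i ord0.
have hdl t : h *m dl t = \sum_(j < (m * p).+1) c t j *: orbit_family f v j.
  by rewrite -(colE t); apply/matrixP => i j; rewrite !mxE (ord1 j).
have ih : isomQ h.
  apply/isomP => x y.
  have ex (z : 'cV[int]_n.+1) : z = \sum_t z t ord0 *: dl t.
    by rewrite {1}(matrix_sum_delta z); apply: eq_bigr => t _; rewrite big_ord1.
  have hx (z : 'cV[int]_n.+1) : h *m z = \sum_t z t ord0 *: (h *m dl t).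
    by rewrite {1}(ex z) mulmx_sumr; apply: eq_bigr => t _; rewrite -scalemxAr.
  rewrite (hx x) (hx y) [in RHS](ex x) [in RHS](ex y) !dot_suml; apply: eq_bigr => s _.
  rewrite !dot_sumr; apply: eq_bigr => t _; rewrite !dotZl !dotZr; congr (_ * (_ * _)).
  rewrite !hdl [dl s]hc [dl t]hc !dot_suml; apply: eq_bigr => i _.
  by rewrite !dot_sumr; apply: eq_bigr => j _; rewrite !dotZl !dotZr G.
have hfam j : (j < (m * p).+1)%N -> h *m orbit_family g w j = orbit_family f v j.
  move=> hj; apply/eqP; rewrite -subr_eq0; set D := _ - _.
  suff e : adj h *m D = 0 by rewrite -[D]mul1mx -(adjr ih) -mulmxA e mulmx0.
  apply/eqP; apply: contraT => D0; case/eqP: D0.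
  suff z t : dot (dl t) (adj h *m D) = 0.
    apply/matrixP => i k; rewrite (ord1 k) [RHS]mxE; move: (z i).
    by rewrite dotC form_delta => /eqP; rewrite mulf_eq0; case: ifP => _ /orP[//|/eqP].
  rewrite dot_adj // dotBr isom_dot // hdl [dl t]hc !dot_suml -sumrB big1 // => i _.
  by rewrite !dotZl G // subrr.
have hpow a k : (a < m)%N -> (k < p)%N -> h *m (g ^+ k *m w a) = f ^+ k *m v a.
  move=> ha hk; have := hfam (a * p + k).+1; rewrite /= modnMDl modn_small //.
  rewrite divnMDl // divn_small // addn0; apply; rewrite ltnS.
  by apply: (@leq_trans (a.+1 * p)); [rewrite mulSn addnC ltn_add2r | rewrite leq_mul2r ha orbT].
have hK0 : h *m Kcl n = Kcl n := hfam 0 isT.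
exists h; split=> //.
have step i : (i < (m * p).+1)%N -> f *m orbit_family f v i = h *m (g *m orbit_family g w i).
  case: i => [|i] /= hi; first by rewrite fK gK hK0.
  rewrite !mulmxA -[f *m _]/(f * _) -exprS -(mulmxA h g) -[g *m _]/(g * _) -exprS -mulmxA.
  have ip : (i %% p < p)%N by rewrite ltn_mod.
  have ia : (i %/ p < m)%N by rewrite ltn_divLR.
  (* At the end of an orbit the exponent reaches p, and the hypotheses [fv] and [gw] close it up. *)
  move: ip; rewrite leq_eqVlt => /orP[/eqP ->|ip]; last by rewrite hpow.
  by rewrite fv // gw // -[w _]mul1mx -[1%:M]/(g ^+ 0) hpow // expr0 mul1mx.
apply/matrixP => i t; suff : (f *m h) *m dl t = (h *m g) *m dl t.
  by rewrite -!(colE t) => /matrixP/(_ i ord0); rewrite !mxE.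
rewrite -!mulmxA hdl [dl t]hc !mulmx_sumr; apply: eq_bigr => j _.
by rewrite -!scalemxAr step.
Qed.

End Transfer.

(** * Evaluating powers of the Coxeter element on lists of integers *)

Section ListVectors.
Variables (n : nat).
Hypothesis (n3 : (3 <= n)%N).
Implicit Types (s t : seq int).

Definition vec_of_seq s : 'cV[int]_n.+1 := \col_i s`_i.
Definition laxpy (a : int) s t := [seq x.1 + a * x.2 | x <- zip s t].
Definition ldot s t : int :=
  s`_0 * t`_0 - foldr (fun x y => x.1 * x.2 + y) 0 (zip (behead s) (behead t)).
Definition lE k : seq int := mkseq (fun i => (i == k)%:R) n.+1.
Definition lK : seq int := -3 :: nseq n 1.
Definition lroots : seq (seq int) :=
  laxpy (-1) (laxpy (-1) (laxpy (-1) (lE 0) (lE 1)) (lE 2)) (lE 3)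
    :: [seq laxpy (-1) (lE i) (lE i.+1) | i <- iota 1 n.-1].
(** The simple roots have square -2, so the reflection in [a] is x + (x . a) a; the last root of the
    list acts first, as in the matrix product [coxeter]. *)
Definition lcox s := foldr (fun a x => laxpy (ldot x a) x a) s lroots.

Lemma size_laxpy a s t : size s = n.+1 -> size t = n.+1 -> size (laxpy a s t) = n.+1.
Proof. by move=> hs ht; rewrite size_map size_zip hs ht minnn. Qed.

Lemma size_lE k : size (lE k) = n.+1. Proof. by rewrite size_mkseq. Qed.

Lemma vec_laxpy a s t : size s = n.+1 -> size t = n.+1 ->
  vec_of_seq (laxpy a s t) = vec_of_seq s + a *: vec_of_seq t.
Proof.
move=> hs ht; apply/matrixP => i j; rewrite !mxE (nth_map (0, 0)) ?size_zip ?hs ?ht ?minnn //.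
by rewrite nth_zip ?hs.
Qed.

Lemma dot_vec s t : size s = n.+1 -> size t = n.+1 -> dot (vec_of_seq s) (vec_of_seq t) = ldot s t.
Proof.
case: s => // x s; case: t => // y t [hs] [ht].
rewrite dot_mink /mink /ldot !mxE /=; congr (_ - _).
rewrite (eq_bigr (fun i : 'I_n => s`_i * t`_i)); last by move=> i _; rewrite !mxE.
elim: s t n hs ht => [|a s ih] [|b t] [|k] //= hs ht; rewrite ?big_ord0 //.
by rewrite big_ord_recl /= (ih t k) //; [case: hs | case: ht].
Qed.

Lemma vec_lE k : (k <= n)%N -> vec_of_seq (lE k) = if k == 0%N then Hcl n else Ecl n k.
Proof.
move=> hk; apply/matrixP => i j; rewrite !mxE nth_mkseq ?ltn_ord //.
have j0 : j == ord0 by case: j => -[].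
by case: (k =P 0%N) => [->|_]; rewrite !mxE j0 andbT -val_eqE //= inordK.
Qed.

Lemma lroots_size : all (fun s => size s == n.+1) lroots.
Proof.
apply/allP => s; rewrite inE => /orP[/eqP->|/mapP[i _ ->]];
  by rewrite !size_laxpy ?size_laxpy ?size_lE.
Qed.

Lemma vec_lroots : map vec_of_seq lroots = simple_roots n.
Proof.
rewrite /lroots map_cons !vec_laxpy ?size_laxpy ?size_lE // !vec_lE ?scaleN1r /=; try lia.
congr (_ :: _); rewrite -map_comp; apply/eq_in_map => i; rewrite mem_iota => hi /=.
rewrite vec_laxpy ?size_lE // !vec_lE ?scaleN1r /=; try lia.
by case: i hi.
Qed.

Definition coxeter : 'M[int]_n.+1 := \prod_(v <- simple_roots n) refl v.

Lemma coxeter_lcox s : size s = n.+1 ->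
  size (lcox s) = n.+1 /\ coxeter *m vec_of_seq s = vec_of_seq (lcox s).
Proof.
move=> hs; rewrite /coxeter /lcox -vec_lroots.
have sub : {subset map vec_of_seq lroots <= simple_roots n} by rewrite vec_lroots.
elim: lroots lroots_size sub => [|a r ih] /=; first by rewrite big_nil mul1mx.
case/andP => /eqP ha hr sub; rewrite big_cons.
have [|h1 h2] := ih hr; first by move=> v hv; apply: sub; rewrite inE hv orbT.
split; first exact: size_laxpy.
have [aa _] := simple_rootP n3 (sub _ (mem_head _ _)).
rewrite -mulmxA h2 refl_mul vec_laxpy // aa -dot_vec // (_ : (2 %/ -2)%Z = -1) //.
by rewrite mulN1r scaleNr opprK.
Qed.

Lemma coxeterX_lcox k s : size s = n.+1 ->
  size (iter k lcox s) = n.+1 /\ coxeter ^+ k *m vec_of_seq s = vec_of_seq (iter k lcox s).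
Proof.
move=> hs; elim: k => [|k [ih1 ih2]]; first by rewrite expr0 mul1mx.
have [h1 h2] := coxeter_lcox ih1.
by rewrite exprS -[_ * _]/(_ *m _) -mulmxA ih2 h2.
Qed.

Lemma vec_lK : vec_of_seq lK = Kcl n.
Proof.
apply/matrixP => i j; rewrite (ord1 j) mxE -[i]inord_val KclE ?leq_ord // inordK //.
by case: (i : nat) (ltn_ord i) => [|k] //= hk; rewrite nth_nseq ifT.
Qed.

(* [W] lists the vectors [w_a] and the columns of [R] are the coefficients of the standard
   basis on the generators [K] and [g^i w_a], where [g = coxeter ^+ k]. *)
Section Check.
Variables (k p : nat) (W R : seq (seq int)) (T : nat -> nat -> nat -> int) (kd : int).
Let m := size W.
Let g := iter k lcox.

Definition lfamily (j : nat) : seq int :=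
  if j is i.+1 then iter (i %% p) g (nth [::] W (i %/ p)) else lK.

Definition coxeter_check : bool :=
  [&& all (fun w => size w == n.+1) W,
      all (fun w => iter p g w == w) W,
      all (fun w => ldot lK w == kd) W,
      all (fun a => all (fun b => all (fun d =>
        ldot (nth [::] W a) (iter d g (nth [::] W b)) == T a b d) (iota 0 p)) (iota 0 m)) (iota 0 m) &
      all (fun l : nat => foldr (fun j x => laxpy (nth [::] R j)`_l x (lfamily j)) (nseq n.+1 0)
         (iota 0 (m * p).+1) == lE l) (iota 0 n.+1)].

Lemma coxeter_transfer (f : 'M[int]_n.+1) (v : nat -> 'cV[int]_n.+1) : (n <= 8)%N ->
  (0 < p)%N -> coxeter_check -> isomQ f -> f *m Kcl n = Kcl n ->
  (forall a, (a < m)%N -> f ^+ p *m v a = v a) ->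
  (forall a, (a < m)%N -> dot (Kcl n) (v a) = kd) ->
  (forall a b d, (a < m)%N -> (b < m)%N -> (d < p)%N -> dot (v a) (f ^+ d *m v b) = T a b d) ->
  exists h, [/\ isomQ h, h *m Kcl n = Kcl n & f *m h = h *m coxeter ^+ k].
Proof.
move=> n8 p0 /and5P[hW hP hK hT hR] hf fK fp fk fT.
have hn : (3 <= n <= 8)%N by rewrite n3.
have coxK : coxeter *m Kcl n = Kcl n by apply: prod_fixK.
have coxi : isomQ coxeter.
  rewrite /coxeter; have := @vroot_sub n.
  elim: (simple_roots n) => [|a r ih] sub; first by rewrite big_nil; apply: isom1.
  rewrite big_cons; apply: isomM; first by apply: (vroot_isom hn); apply: sub; rewrite mem_head.
  by apply: ih => w hw; apply: sub; rewrite inE hw orbT.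
have sW a : (a < m)%N -> size (nth [::] W a) = n.+1.
  by move=> ha; apply/eqP/(allP hW)/mem_nth.
pose w a := vec_of_seq (nth [::] W a).
have gX s d : size s = n.+1 -> size (iter d g s) = n.+1 /\
    (coxeter ^+ k) ^+ d *m vec_of_seq s = vec_of_seq (iter d g s).
  move=> hs; rewrite -exprM; suff -> : iter d g s = iter (k * d) lcox s by apply: coxeterX_lcox.
  by elim: d => [|d ih]; [rewrite muln0 | rewrite mulnS iterD /= ih].
apply: (@transfer n m p f _ v w (fun l j => (nth [::] R j)`_l)) => //.
- exact: isomX.
- exact: expfix.
- move=> a ha; have [_ ->] := gX _ p (sW a ha).
  by congr vec_of_seq; apply/eqP/(allP hP)/mem_nth.
- move=> a ha; rewrite fk // -vec_lK dot_vec ?sW //=; last by rewrite size_nseq.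
  by apply/esym/eqP/(allP hK)/mem_nth.
- move=> a b d ha hb hd; rewrite fT //; have [h1 ->] := gX _ d (sW b hb).
  rewrite dot_vec ?sW //; apply/esym/eqP.
  have := allP hT a; rewrite mem_iota ha => /(_ isT)/allP/(_ b); rewrite mem_iota hb.
  by move=> /(_ isT)/allP/(_ d); rewrite mem_iota hd => /(_ isT).
move=> l; have := allP hR l; rewrite mem_iota ltn_ord => /(_ isT)/eqP e.
have -> : delta_mx l ord0 = vec_of_seq (lE l).
  apply/matrixP => i j; rewrite !mxE nth_mkseq ?ltn_ord //.
  by have -> : j == ord0 by [case: j => -[]]; rewrite andbT.
rewrite -e -(big_mkord xpredT (fun j => (nth [::] R j)`_l *: orbit_family p (coxeter ^+ k) w j)).
have lf j : (j < (m * p).+1)%N -> size (lfamily j) = n.+1 /\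
    vec_of_seq (lfamily j) = orbit_family p (coxeter ^+ k) w j.
  case: j => [|j] hj /=; first by rewrite vec_lK size_nseq.
  by have [|h1 h2] := gX (nth [::] W (j %/ p)) (j %% p)%N; [apply: sW; rewrite ltn_divLR|].
rewrite /index_iota subn0.
have : all (fun j => j < (m * p).+1)%N (iota 0 (m * p).+1).
  by apply/allP => j; rewrite mem_iota.
move: (iota _ _) => r hr.
suff [] : size (foldr (fun j x => laxpy (nth [::] R j)`_l x (lfamily j)) (nseq n.+1 0) r) = n.+1
    /\ vec_of_seq (foldr (fun j x => laxpy (nth [::] R j)`_l x (lfamily j)) (nseq n.+1 0) r)
      = \sum_(j <- r) (nth [::] R j)`_l *: orbit_family p (coxeter ^+ k) w j by [].
elim: r hr => [|j r ih] hr.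
  rewrite big_nil /= size_nseq; split=> //; apply/matrixP => i j.
  by rewrite !mxE -[_ :: _]/(nseq n.+1 0) nth_nseq if_same.
case/andP: hr => /lf[h1 h2] /ih[h3 h4] /=.
by rewrite size_laxpy // vec_laxpy // h4 h2 big_cons addrC.
Qed.

End Check.
End ListVectors.

(** Gram data of orbits arranged in a transitive tournament: [diag] lists v_a . f^d v_a and [arc]
    lists v_a . f^d v_b for a < b. For a > b the value is forced by v_a . f^d v_b = v_b . f^(p - d)
    v_a. *)
Definition pattern (p : nat) (diag arc : seq int) (a b d : nat) : int :=
  if a == b then diag`_d else if (a < b)%N then arc`_d else arc`_((p - d) %% p).

(* The orbits of the vectors of [frame_i] under a power of the Coxeter element have the
   required Gram matrix; the columns of [dual_i] write the standard basis in terms of [K]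
   and these orbits. *)
Definition frame4 : seq (seq int) := [:: [:: 0; 0; 1; 0; 0]].
Definition dual4 : seq (seq int) :=
[:: [:: 0; 0; 0; 0; 0];
 [:: 1; 0; 1; 1; 0];
 [:: 1; 0; 0; 1; 1];
 [:: 1; 1; 0; 0; 1];
 [:: 0; 0; 0; -1; 0];
 [:: 0; 0; 0; 0; -1]].

Definition frame6 : seq (seq int) :=
  [:: [:: 0; 0; 0; 0; 0; 0; 1]; [:: 0; 1; 0; 0; 0; 0; 0]; [:: 1; 0; -1; -1; 0; 0; 0]].
Definition dual6 : seq (seq int) :=
[:: [:: 0; 0; 0; 0; 0; 0; 0];
 [:: 1; 0; 0; 1; 0; 0; 1];
 [:: 0; 0; -1; 1; 0; -1; 0];
 [:: 1; 0; 0; 1; 1; 0; 0];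
 [:: 1; 1; 1; 0; 0; 1; 0];
 [:: 0; 0; 0; 0; -1; 1; 0];
 [:: 0; 0; 0; 0; 0; 0; 0];
 [:: 0; 0; 0; -1; 1; 0; 0];
 [:: 0; 0; 1; -1; 0; 0; 0]].

Definition frame8 : seq (seq int) :=
  [:: [:: 0; 0; 0; 0; 0; 0; 0; 0; 1]; [:: 1; -1; 0; -1; 0; 0; 0; 0; 0];
      [:: 1; 0; -1; -1; 0; 0; 0; 0; 0]; [:: 1; 0; 0; -1; -1; 0; 0; 0; 0]].
Definition dual8 : seq (seq int) :=
[:: [:: -4; -2; -2; -2; -2; -2; -1; 0; 0];
 [:: 0; 0; 0; 0; 0; 0; -1; 0; 1];
 [:: -1; 0; 0; -1; 0; 0; -1; -1; 0];
 [:: 0; 0; 0; 0; 0; 0; 0; 0; 0];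
 [:: 0; -1; 0; 0; 0; 0; 0; 1; 0];
 [:: 0; 0; 0; 0; 0; 0; -1; 1; 0];
 [:: 0; 0; 0; 0; 0; 0; 0; 0; 0];
 [:: 0; 0; -1; 0; 0; 0; 1; 0; 0];
 [:: -1; -1; -1; 0; -1; 0; 0; 0; 0];
 [:: 0; 0; 0; 0; 0; 0; 0; 0; 0];
 [:: 1; 1; 1; 0; 0; 0; 1; 0; 0];
 [:: 0; 0; 0; 0; 0; -1; 1; 0; 0]].

Definition frame8A : seq (seq int) :=
  [:: [:: -2; 0; 1; 1; 1; 0; 1; 1; 1]; [:: -2; 1; 1; 1; 0; 0; 1; 1; 1]].
Definition dual8A : seq (seq int) :=
[:: [:: -3; -1; -1; -1; -1; -1; -1; -1; -1];
 [:: 0; -1; 0; 0; 0; 0; 0; 0; 1];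
 [:: -1; -1; -1; 0; -1; 0; 0; -1; 1];
 [:: -2; -1; -2; 0; -1; -1; 0; -1; 0];
 [:: -1; 0; -1; 0; 0; -1; 0; -1; 0];
 [:: 0; 0; 0; 0; 0; 0; 0; 0; 0];
 [:: 1; 1; 1; 0; 0; 0; 0; 1; 0];
 [:: 0; 0; 1; -1; 0; 0; -1; 1; 0];
 [:: -1; -1; 1; -1; -1; 0; -1; 0; 0];
 [:: -1; -1; 0; 0; -1; 0; -1; 0; 0]].

Definition frame8C : seq (seq int) :=
  [:: [:: -2; 0; 1; 1; 1; 0; 1; 1; 1]; [:: -2; 1; 1; 1; 1; 0; 0; 1; 1]].
Definition dual8C : seq (seq int) :=
[:: [:: -3; -1; -1; -1; -1; -1; -1; -1; -1];
 [:: 1; 0; 0; 0; 1; 0; 1; 0; 1];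
 [:: 1; 1; 0; 0; 0; 0; 1; 0; 1];
 [:: -1; 0; -1; -1; 0; -1; 0; 0; 0];
 [:: -1; 0; 0; -1; 0; -1; 0; -1; 0];
 [:: 0; 0; 0; 0; 0; 0; 0; 0; 0];
 [:: 0; 0; 0; 0; 0; 0; -1; 1; 0];
 [:: -1; -1; 0; -1; 0; 0; -1; 0; 0];
 [:: -1; -1; 0; 0; -1; 0; -1; 0; 0];
 [:: -1; -1; -1; 0; 0; 0; -1; 0; 0]].

(** The exponents 1, 4, 10 and 6 in these checks are h / p for the Coxeter numbers h = 5, 12, 30 of
    W_4, W_6, W_8, of types A_4, E_6, E_8. *)
Lemma check4 : coxeter_check 4 1 5 frame4 dual4 (pattern 5 [:: -1; 1; 0; 0; 1] [::]) (-1).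
Proof. by vm_compute. Qed.
Lemma check6 : coxeter_check 6 4 3 frame6 dual6 (pattern 3 [:: -1; 1; 1] [:: 0; 1; 0]) (-1).
Proof. by vm_compute. Qed.
Lemma check8 : coxeter_check 8 10 3 frame8 dual8 (pattern 3 [:: -1; 2; 2] [:: 0; 2; 1]) (-1).
Proof. by vm_compute. Qed.
Lemma check8A : coxeter_check 8 6 5 frame8A dual8A
  (pattern 5 [:: -2; 1; 0; 0; 1] [:: -1; 1; 0; 0; 0]) 0.
Proof. by vm_compute. Qed.
Lemma check8C : coxeter_check 8 6 5 frame8C dual8C
  (pattern 5 [:: -2; 1; 0; 0; 1] [:: -1; 1; -1; 1; 0]) 0.
Proof. by vm_compute. Qed.

(** At least half of the tournament consists of successors of the first vertex together with it, or
    of the other vertices together with it; a chain found there is prolonged by this vertex, in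
    front or at the end. *)
Lemma tournament_chain (T : eqType) (r : rel T) (k : nat) (s : seq T) : uniq s ->
  {in s &, forall x y, x != y -> r x y || r y x} -> (2 ^ k <= size s)%N ->
  exists t, [/\ size t = k.+1, uniq t, {subset t <= s} & pairwise r t].
Proof.
elim: k s => [|k ih] [|x s] //=.
    by move=> *; exists [:: x]; split=> // y; rewrite inE => /eqP->; rewrite mem_head.
  by rewrite leqNgt expn_gt0.
move=> /andP[xs us] tot sz.
have subt (q : pred T) : {subset filter q s <= s} by move=> y; rewrite mem_filter => /andP[].
have tot' (q : pred T) : {in filter q s &, forall y z, y != z -> r y z || r z y}.
  by move=> y z /subt ys /subt zs; apply: tot; rewrite inE ?ys ?zs orbT.
have : (2 ^ k <= size (filter (r x) s))%N || (2 ^ k <= size (filter (predC (r x)) s))%N.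
  by move: sz; rewrite -(count_predC (r x) s) !size_filter expnS; case: leqP => //=; lia.
case/orP => [/(ih _ (filter_uniq _ us) (tot' _))|/(ih _ (filter_uniq _ us) (tot' _))]
  [t [st ut sub pt]].
  exists (x :: t); split => /=; rewrite ?st //.
  - by rewrite ut andbT; apply: contra xs => /sub/subt.
  - by move=> y; rewrite !inE => /orP[->//|/sub/subt->]; rewrite orbT.
  by rewrite pt andbT; apply/allP => y /sub; rewrite mem_filter => /andP[].
exists (rcons t x); split; rewrite ?size_rcons ?st //.
- by rewrite rcons_uniq ut andbT; apply: contra xs => /sub/subt.
- by move=> y; rewrite mem_rcons !inE => /orP[->//|/sub/subt->]; rewrite orbT.
rewrite pairwise_rcons pt andbT; apply/allP => y /sub; rewrite mem_filter /= => /andP[nr ys].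
have : y != x by apply: contraNneq xs => <-.
move/(tot _ _ _ _) => /(_ _ _)/orP; rewrite !inE ys orbT eqxx => /(_ isT isT)[//|].
by rewrite (negbTE nr).
Qed.

(** * Products between orbits of exceptional classes *)

Section Exceptional.
Variables (n : nat).
Hypothesis (hn : (3 <= n <= 8)%N).
Variable (f : 'M[int]_n.+1).
Hypotheses (hf : isomQ f) (fK : f *m Kcl n = Kcl n).
Implicit Types (x y : 'cV[int]_n.+1).

Lemma dotK_pow d x : dot (Kcl n) (f ^+ d *m x) = dot (Kcl n) x.
Proof. by rewrite -{1}(expfix d fK) isom_dot //; apply: isomX. Qed.

(** The nonzero vector x - y lies in K^perp, which is negative definite. *)
Lemma exceptional_ge x y : dot x x = -1 -> dot y y = -1 -> dot (Kcl n) x = dot (Kcl n) y ->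
  x != y -> 0 <= dot x y.
Proof.
move=> xx yy Kxy xy; have := @dot_orth n (x - y) _ (fwdK hn).
rewrite dotC dotNl dotBr Kxy subrr oppr0 subr_eq0 => /(_ erefl xy).
by rewrite dotBl !dotBr xx yy (dotC y x); lia.
Qed.

Lemma exceptional_pow d x y : dot x x = -1 -> dot y y = -1 -> dot (Kcl n) x = dot (Kcl n) y ->
  0 <= dot x (f ^+ d *m y) \/ x = f ^+ d *m y.
Proof.
move=> xx yy Kxy; case: (eqVneq x (f ^+ d *m y)) => [|ne]; [by right|left].
by apply: exceptional_ge ne; rewrite ?dotK_pow // isom_dot //; apply: isomX.
Qed.

Definition exceptionals : seq 'cV[int]_n.+1 := [seq Ecl n i | i <- iota 1 n].

Lemma exceptionals_uniq : uniq exceptionals.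
Proof.
rewrite map_inj_in_uniq ?iota_uniq // => i j; rewrite !mem_iota => hi hj e.
have := @dotEE n i j ltac:(lia) ltac:(lia); rewrite e dotEE; [|lia|lia].
by rewrite eqxx; case: eqP.
Qed.

Lemma size_exceptionals : size exceptionals = n.
Proof. by rewrite size_map size_iota. Qed.

Lemma exceptionalP x : x \in exceptionals -> dot x x = -1 /\ dot (Kcl n) x = -1.
Proof.
case/mapP => i; rewrite mem_iota => hi ->; rewrite dotKE ?dotEE ?eqxx //; lia.
Qed.

Lemma exceptional_orth x y : x \in exceptionals -> y \in exceptionals -> x != y -> dot x y = 0.
Proof.
case/mapP => i hi ->; case/mapP => j hj -> ij; rewrite !mem_iota in hi hj.
by rewrite dotEE; [|lia|lia]; case: (i =P j) ij => [->|_ _]; rewrite ?eqxx ?oppr0.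
Qed.

End Exceptional.

Section Cases.
Variables (n p : nat).
Variable (f : 'M[int]_n.+1).
Hypotheses (hf : isomQ f) (fp : f ^+ p = 1) (p0 : (0 < p)%N).
Implicit Types (x y : 'cV[int]_n.+1).

Lemma powp x : f ^+ p *m x = x. Proof. by rewrite fp mul1mx. Qed.

Lemma pow_mod d x : f ^+ (d %% p) *m x = f ^+ d *m x.
Proof. by rewrite {2}(divn_eq d p) exprD mulnC exprM fp expr1n mul1r. Qed.

Lemma dot_pow_sym d x y : (d <= p)%N -> dot x (f ^+ d *m y) = dot y (f ^+ (p - d) *m x).
Proof.
move=> dp; rewrite -[in LHS](isom_dot _ _ (isomX (p - d) hf)).
rewrite [X in dot _ X]mulmxA -[f ^+ _ *m f ^+ _]/(f ^+ _ * f ^+ _) -exprD subnK // powp.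
exact: dotC.
Qed.

Lemma pattern_chain diag arc (t : seq 'cV[int]_n.+1) :
  {in t, forall x d, (d < p)%N -> dot x (f ^+ d *m x) = diag`_d} ->
  pairwise (fun x y => all (fun d => dot x (f ^+ d *m y) == arc`_d) (iota 0 p)) t ->
  forall a b d, (a < size t)%N -> (b < size t)%N -> (d < p)%N ->
    dot t`_a (f ^+ d *m t`_b) = pattern p diag arc a b d.
Proof.
move=> hd /(pairwiseP 0) ha a b d hat hbt hdp; rewrite /pattern.
case: eqP => [->|/eqP ab]; first by rewrite hd // mem_nth.
have A c e k : (c < size t)%N -> (e < size t)%N -> (c < e)%N -> (k < p)%N ->
    dot t`_c (f ^+ k *m t`_e) = arc`_k.
  by move=> hc he ce hk; apply/eqP; apply: (allP (ha c e hc he ce)); rewrite mem_iota.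
case: ltnP => lt; first exact: A.
rewrite dot_pow_sym; last exact: ltnW.
by rewrite -pow_mod A ?ltn_mod //; rewrite ltn_neqAle eq_sym ab.
Qed.

End Cases.

Lemma conj_pow (n : nat) (f g h : 'M[int]_n.+1) k : f *m h = h *m g -> f ^+ k *m h = h *m g ^+ k.
Proof.
move=> e; elim: k => [|k ih]; first by rewrite !expr0 mul1mx mulmx1.
rewrite exprS exprSr -[f * _]/(f *m _) -[_ * g]/(_ *m g).
by rewrite -mulmxA ih mulmxA e -!mulmxA -[g *m _]/(g * _) -exprS exprSr.
Qed.

(* The identity [(9 - n) (x + f x + ... + f^(p-1) x) = p (x . K) K], paired with [y]. *)
Definition orbit_pairing (n p : nat) (f : 'M[int]_n.+1) := forall x y : 'cV[int]_n.+1,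
  (9 - n%:Z) * \sum_(i < p) dot y (f ^+ i *m x) = p%:Z * (dot (Kcl n) x * dot (Kcl n) y).

Definition coxeter_conj (n : nat) (f : 'M[int]_n.+1) :=
  exists h k, [/\ isomQ h, h *m Kcl n = Kcl n & f *m h = h *m coxeter n ^+ k].

(** Allows passing to another generator of the cyclic group of [f], when that one has the tabulated
    products. *)
Lemma coxeter_conj_pow (n p k : nat) (f : 'M[int]_n.+1) j : f ^+ p = 1 -> (k * j = 1 %[mod p])%N ->
  coxeter_conj (f ^+ k) -> coxeter_conj f.
Proof.
move=> fp kj [h [l [h1 h2 h3]]]; exists h, (l * j)%N; split=> //.
have := conj_pow j h3; rewrite -!exprM => <-.
have -> : f ^+ (k * j) = f ^+ (k * j %% p).
  by rewrite {1}(divn_eq (k * j) p) exprD mulnC exprM fp expr1n mul1r.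
by rewrite kj -[in LHS](expr1 f) {1}(divn_eq 1 p) exprD mulnC exprM fp expr1n mul1r.
Qed.

Lemma coxeter_chain (n k p : nat) W R diag arc kd (f : 'M[int]_n.+1) (t : seq 'cV[int]_n.+1) :
  (3 <= n <= 8)%N -> (0 < p)%N -> coxeter_check n k p W R (pattern p diag arc) kd ->
  isomQ f -> f *m Kcl n = Kcl n -> f ^+ p = 1 -> size t = size W ->
  {in t, forall x, dot (Kcl n) x = kd} ->
  {in t, forall x d, (d < p)%N -> dot x (f ^+ d *m x) = diag`_d} ->
  pairwise (fun x y => all (fun d => dot x (f ^+ d *m y) == arc`_d) (iota 0 p)) t ->
  coxeter_conj f.
Proof.
move=> hn p0 hc hf fK fp st hK hd ha; have /andP[n3 n8] := hn.
have [h hh] : exists h, [/\ isomQ h, h *m Kcl n = Kcl n & f *m h = h *m coxeter n ^+ k].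
  apply: (@coxeter_transfer n n3 k p W R _ kd f (nth 0 t) n8 p0 hc hf fK).
  - by move=> a _; rewrite fp mul1mx.
  - by move=> a hat; apply: hK; apply: mem_nth; rewrite st.
  by rewrite -st; apply: (pattern_chain hf fp p0 hd ha).
by exists h, k.
Qed.

(** For b_i = e . f^i e the pairing gives b_1 + b_2 = 1. This excludes that a power f^i, 0 < i < 5,
    fixes [e], so both are nonnegative; if b_2 = 1, then f^2 has the products required of [f]. *)
Lemma coxeter_conj_n4_p5 (f : 'M[int]_5) : isomQ f -> f *m Kcl 4 = Kcl 4 -> f ^+ 5 = 1 ->
  orbit_pairing 5 f -> coxeter_conj f.
Proof.
move=> hf fK fp hs; set e := Ecl 4 1.
have ee : dot e e = -1 by rewrite dotEE.
have Ke : dot (Kcl 4) e = -1 by rewrite dotKE.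
have main g : isomQ g -> g *m Kcl 4 = Kcl 4 -> g ^+ 5 = 1 ->
    dot e (g ^+ 1 *m e) = 1 -> dot e (g ^+ 2 *m e) = 0 -> coxeter_conj g.
  move=> hg gK gp b1 b2.
  have b3 : dot e (g ^+ 3 *m e) = 0 by rewrite (dot_pow_sym hg gp).
  have b4 : dot e (g ^+ 4 *m e) = 1 by rewrite (dot_pow_sym hg gp).
  apply: (@coxeter_chain 4 1 5 frame4 dual4 _ _ _ g [:: e] isT isT check4 hg gK gp erefl) => [x|x|].
  - by rewrite inE => /eqP->.
  - rewrite inE => /eqP-> [|[|[|[|[|d]]]]] //= _; by rewrite expr0 mul1mx.
  by [].
have := hs e e; rewrite !big_ord_recr big_ord0 /= expr0 mul1mx ee Ke.
rewrite (dot_pow_sym hf fp (d := 3)) // (dot_pow_sym hf fp (d := 4)) //=.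
have g1 := exceptional_pow (n := 4) isT hf fK 1 ee ee erefl.
have g2 := exceptional_pow (n := 4) isT hf fK 2 ee ee erefl.
move: g1 g2; set b1 := dot e (f ^+ 1 *m e); set b2 := dot e (f ^+ 2 *m e) => g1 g2 sum.
have h1 : f ^+ 1 *m e = e -> b1 = -1 /\ b2 = -1.
  by move=> fe; rewrite /b1 fe /b2 (exprM f 1 2) (expfix 2 fe).
have h2 : f ^+ 2 *m e = e -> f ^+ 1 *m e = e.
  by move=> fe; rewrite (pow_mod fp 6 e : f ^+ 1 *m e = _) (exprM f 2 3) (expfix 3 fe).
have [[e1 e2]|[e1 e2]] : (b1 = 1 /\ b2 = 0) \/ (b1 = 0 /\ b2 = 1).
  case: g1 => [g1|/esym/h1[]]; last by lia.
  by case: g2 => [g2|/esym/h2/h1[]]; lia.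
  exact: main.
apply: (@coxeter_conj_pow 4 5 2 f 3 fp) => //; apply: main.
- exact: isomX.
- exact: expfix.
- by rewrite -exprM mulnC exprM fp expr1n.
- by rewrite expr1.
by rewrite -exprM (dot_pow_sym hf fp).
Qed.

(** * Order 3: orienting pairs of exceptional classes *)

Section Order3.
Variables (n : nat) (f : 'M[int]_n.+1).
Hypotheses (hn : (3 <= n <= 8)%N) (hf : isomQ f) (fK : f *m Kcl n = Kcl n) (fp : f ^+ 3 = 1).
Hypothesis (hs : orbit_pairing 3 f).
Implicit Types (x y : 'cV[int]_n.+1).

Lemma order3_pairing x y : x \in exceptionals n -> y \in exceptionals n ->
  (9 - n%:Z) * (dot x y + dot x (f *m y) + dot x (f ^+ 2 *m y)) = 3.
Proof.
move=> hx hy; have [_ Kx] := exceptionalP hx; have [_ Ky] := exceptionalP hy.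
by have := hs y x; rewrite !big_ord_recr big_ord0 /= add0r expr0 expr1 mul1mx Kx Ky.
Qed.

Lemma order3_sym x y : dot x (f ^+ 2 *m y) = dot y (f *m x).
Proof. by rewrite (dot_pow_sym hf fp) //= expr1. Qed.

Lemma order3_diag x : x \in exceptionals n ->
  (9 - n%:Z) * (2 * dot x (f *m x) - 1) = 3.
Proof.
move=> hx; have [xx _] := exceptionalP hx.
by rewrite -(order3_pairing hx hx) order3_sym xx; congr (_ * _); ring.
Qed.

Lemma order3_arc x y : x \in exceptionals n -> y \in exceptionals n -> x != y ->
  (9 - n%:Z) * (dot x (f *m y) + dot y (f *m x)) = 3.
Proof.
move=> hx hy xy; rewrite -(order3_pairing hx hy) order3_sym.
by rewrite (exceptional_orth hn hx hy xy) add0r.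
Qed.

Lemma order3_ge0 x y : x \in exceptionals n -> y \in exceptionals n -> x != y ->
  0 < dot x (f *m x) -> 0 <= dot x (f *m y).
Proof.
move=> hx hy xy px; have [xx Kx] := exceptionalP hx; have [yy Ky] := exceptionalP hy.
have Kxy : dot (Kcl n) x = dot (Kcl n) y by rewrite Kx Ky.
have [//|e] := exceptional_pow hn hf fK 1 xx yy Kxy.
(* Here x = f y, so y . f y = y . x = 0, against [order3_diag]. *)
have : dot y x = dot y (f *m y) by rewrite {1}e expr1.
rewrite dotC (exceptional_orth hn hx hy xy) => e0.
have := order3_diag hy; have := order3_diag hx; nia.
Qed.

Definition arc3 (c1 c2 : int) x y :=
  all (fun d => dot x (f ^+ d *m y) == [:: 0; c1; c2]`_d) (iota 0 3).

Lemma arc3E c1 c2 x y : x \in exceptionals n -> y \in exceptionals n -> x != y ->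
  dot x (f *m y) = c1 -> dot y (f *m x) = c2 -> arc3 c1 c2 x y.
Proof.
move=> hx hy xy h1 h2; rewrite /arc3 /= expr0 mul1mx (exceptional_orth hn hx hy xy).
by rewrite expr1 order3_sym h1 h2 !eqxx.
Qed.

Lemma diag3 b x d : x \in exceptionals n -> dot x (f *m x) = b -> (d < 3)%N ->
  dot x (f ^+ d *m x) = [:: -1; b; b]`_d.
Proof.
move=> hx hb; have [xx _] := exceptionalP hx.
by case: d => [|[|[|d]]] //= _; rewrite ?expr0 ?mul1mx ?order3_sym ?expr1.
Qed.

End Order3.

(** The products x . f y and y . f x are nonnegative with sum 1, which orients every pair of E_1,
    ..., E_6; four vertices already contain a chain of three. *)
Lemma coxeter_conj_n6_p3 (f : 'M[int]_7) : isomQ f -> f *m Kcl 6 = Kcl 6 -> f ^+ 3 = 1 ->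
  orbit_pairing 3 f -> coxeter_conj f.
Proof.
move=> hf fK fp hs; have hn : (3 <= 6 <= 8)%N by [].
have hd x : x \in exceptionals 6 -> dot x (f *m x) = 1.
  by move=> hx; have := order3_diag hf fp hs hx; lia.
have tot : {in exceptionals 6 &, forall x y, x != y -> arc3 f 1 0 x y || arc3 f 1 0 y x}.
  move=> x y hx hy xy; have yx : y != x by rewrite eq_sym.
  have a1 := order3_ge0 hn hf fK fp hs hx hy xy; have a2 := order3_ge0 hn hf fK fp hs hy hx yx.
  rewrite !hd // in a1 a2.
  have := order3_arc hn hf fp hs hx hy xy => e.
  have [e1|e1] : dot x (f *m y) = 1 \/ dot x (f *m y) = 0 by have := a1 isT; have := a2 isT; lia.
    by apply/orP; left; apply: arc3E => //; lia.
  by apply/orP; right; apply: arc3E => //; lia.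
have [|t [st _ sub pt]] := tournament_chain (k := 2) (exceptionals_uniq hn) tot.
  by rewrite size_exceptionals.
apply: (@coxeter_chain 6 4 3 frame6 dual6 _ _ _ f t isT isT check6 hf fK fp) => //.
  by move=> x /sub hx; have [] := exceptionalP hx.
by move=> x /sub hx d hd'; apply: diag3 => //; apply: hd.
Qed.

(** Now x . f y and y . f x are nonnegative with sum 3. If 3 never occurs, 2 against 1 orients all
    pairs of E_1, ..., E_8, and there is a chain of four. If x . f y = 3, the six classes other than
    x and y still form a tournament, and x precedes all of them, so a chain of three among them
    suffices. *)
Lemma coxeter_conj_n8_p3 (f : 'M[int]_9) : isomQ f -> f *m Kcl 8 = Kcl 8 -> f ^+ 3 = 1 ->
  orbit_pairing 3 f -> coxeter_conj f.
Proof.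
move=> hf fK fp hs; have hn : (3 <= 8 <= 8)%N by [].
have hd x : x \in exceptionals 8 -> dot x (f *m x) = 2.
  by move=> hx; have := order3_diag hf fp hs hx; lia.
suff [t [st sub pt]] : exists t, [/\ size t = 4%N, {subset t <= exceptionals 8}
    & pairwise (arc3 f 2 1) t].
  apply: (@coxeter_chain 8 10 3 frame8 dual8 _ _ _ f t isT isT check8 hf fK fp) => //.
    by move=> x /sub hx; have [] := exceptionalP hx.
  by move=> x /sub hx d hd'; apply: diag3 => //; apply: hd.
have split3 (a b : int) : a + b = 3 -> 0 <= a -> 0 <= b -> a <> 3 -> b <> 3 -> a = 2 \/ b = 2.
  by move=> *; lia.
pose S := exceptionals 8.
have sum x y : x \in S -> y \in S -> x != y -> dot x (f *m y) + dot y (f *m x) = 3.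
  by move=> hx hy xy; have := order3_arc hn hf fp hs hx hy xy; lia.
have ge x y : x \in S -> y \in S -> x != y -> 0 <= dot x (f *m y).
  by move=> hx hy xy; apply: (order3_ge0 hn hf fK fp hs hx hy xy); rewrite hd.
have arc x y : x \in S -> y \in S -> x != y -> dot x (f *m y) = 2 -> arc3 f 2 1 x y.
  by move=> hx hy xy e; have := sum x y hx hy xy; move=> e'; apply: arc3E => //; lia.
(* If [x . f y = 3] then [f y = - 2 K - x], which decides all products with [x] and [y]. *)
have opp x y : x \in S -> y \in S -> dot x (f *m y) = 3 ->
    forall z, z \in S -> z != x -> z != y -> dot z (f *m y) = 2 /\ dot x (f *m z) = 2.
  move=> hx hy e3 z hz zx zy.
  have [xx Kx] := exceptionalP hx; have [yy Ky] := exceptionalP hy.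
  have [zz Kz] := exceptionalP hz.
  have Kfy : dot (Kcl 8) (f *m y) = -1 by rewrite -(expr1 f) dotK_pow.
  have Kfz : dot (Kcl 8) (f *m z) = -1 by rewrite -(expr1 f) dotK_pow.
  have fyy : dot (f *m y) (f *m y) = -1 by rewrite isom_dot.
  have KK : dot (Kcl 8) (Kcl 8) = 1 by rewrite dotKK.
  pose w := x + f *m y + 2 *: Kcl 8.
  have w0 : w = 0.
    apply/eqP; apply: contraT => ne; have := dot_orth (fwdK hn) _ ne.
    rewrite /w dotNr dotDl dotZl dotDl !(dotC _ (Kcl 8)) Kx Kfy KK => /(_ erefl).
    rewrite !dotDl !dotDr !dotZl !dotZr (dotC (f *m y) x) (dotC x (Kcl 8)) (dotC (f *m y) (Kcl 8)).
    by rewrite fyy xx Kx Kfy KK e3.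
  have zw : dot z w = 0 by rewrite w0 dot0r.
  have fzw : dot (f *m z) w = 0 by rewrite w0 dot0r.
  move: zw fzw; rewrite /w !dotDr !dotZr !(dotC _ (Kcl 8)) Kz Kfz isom_dot //.
  rewrite (exceptional_orth hn hz hx zx) (exceptional_orth hn hz hy zy) (dotC (f *m z)).
  by split; lia.
have [/hasP[x hx /hasP[y hy /andP[xy /eqP e3]]]|no3] :=
  boolP (has (fun x => has (fun y => (x != y) && (dot x (f *m y) == 3)) S) S); last first.
  have tot : {in S &, forall x y, x != y -> arc3 f 2 1 x y || arc3 f 2 1 y x}.
    move=> x y hx hy xy; have yx : y != x by rewrite eq_sym.
    have n3 u v : u \in S -> v \in S -> u != v -> dot u (f *m v) <> 3.
      move=> hu hv uv e; case/hasP: no3; exists u => //; apply/hasP; exists v => //.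
      by rewrite uv e eqxx.
    have [e|e] := split3 _ _ (sum x y hx hy xy) (ge x y hx hy xy) (ge y x hy hx yx)
      (n3 x y hx hy xy) (n3 y x hy hx yx).
      by rewrite arc.
    by rewrite orbC arc.
  have [|t [st _ sub pt]] := tournament_chain (k := 3) (exceptionals_uniq hn) tot.
    by rewrite size_exceptionals.
  by exists t.
pose S' := filter (fun z => (z != x) && (z != y)) S.
have sub' z : z \in S' -> [/\ z \in S, z != x & z != y].
  by rewrite mem_filter => /andP[/andP[]].
have S'u : uniq S' by apply: filter_uniq; apply: (exceptionals_uniq hn).
have S'6 : (2 ^ 2 <= size S')%N.
  have : (size S <= size (x :: y :: S'))%N.
    apply: uniq_leq_size; first exact: (exceptionals_uniq hn).
    by move=> z hz; rewrite !inE mem_filter hz andbT; case: eqP; case: eqP.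
  by rewrite size_exceptionals /= (_ : 2 ^ 2 = 4)%N //; lia.
have tot : {in S' &, forall u v, u != v -> arc3 f 2 1 u v || arc3 f 2 1 v u}.
  move=> u v hu' hv' uv; have vu : v != u by rewrite eq_sym.
  have [hu ux uy] := sub' u hu'; have [hv vx vy] := sub' v hv'.
  (* A second pair with a . f b = 3 would give a . f x = x . f a = 2, but these two products have
     sum 3. *)
  have n3 a b : a \in S' -> b \in S' -> a != b -> dot a (f *m b) <> 3.
    move=> ha' hb' ab e; have [ha ax ay] := sub' a ha'; have [hb bx by_] := sub' b hb'.
    have [_ e1] := opp a b ha hb e x hx ltac:(by rewrite eq_sym) ltac:(by rewrite eq_sym).
    have [_ e2] := opp x y hx hy e3 a ha ax ay.
    by have := sum a x ha hx ax; rewrite e1 e2.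
  have [e|e] := split3 _ _ (sum u v hu hv uv) (ge u v hu hv uv) (ge v u hv hu vu)
    (n3 u v hu' hv' uv) (n3 v u hv' hu' vu).
    by rewrite arc.
  by rewrite orbC arc.
have [t [st _ sub pt]] := tournament_chain S'u tot S'6.
exists (x :: t); split; first by rewrite /= st.
  by move=> z; rewrite inE => /orP[/eqP->//|/sub/sub'[]].
rewrite /= pt andbT; apply/allP => z /sub/sub'[hz zx zy].
by apply: arc => //; [rewrite eq_sym | have [_ ->] := opp x y hx hy e3 z hz zx zy].
Qed.

(** * Order 5 on the roots of E_8 *)

Definition sum5 (F : nat -> int) : int := F 0 + F 1 + F 2 + F 3 + F 4.

(* The square of [sum_k c_k f^k a + sum_k d_k f^k b], where [A], [B] and [X] list the
   products [a . f^j a], [b . f^j b] and [a . f^j b]. *)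
Definition orbit_form (c d A B X : seq int) : int :=
  sum5 (fun k => sum5 (fun l => c`_k * c`_l * A`_((l + 5 - k) %% 5)
    + d`_k * d`_l * B`_((l + 5 - k) %% 5) + 2 * (c`_k * d`_l * X`_((l + 5 - k) %% 5)))).

(** Products of a root with its five images when these form the cyclic diagram of affine type A_4,
    neighbours being a and f a. *)
Definition norm5 : seq int := [:: -2; 1; 0; 0; 1].

(** The possible products a . f^j b, j = 1, ..., 4, for two roots with products [norm5] and a . b =
    -1. The 2 in the first two lists makes b opposite to an image of a. Up to sign and a cyclic
    shift, the next two lists are the pattern of [frame8A] and the last four that of [frame8C]. *)
Definition products5 : seq (seq int) :=
  [:: [:: 2; -1; 0; 0]; [:: 0; 0; -1; 2]; [:: 1; 0; 0; 0]; [:: 0; 0; 0; 1];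
      [:: 1; 0; -1; 1]; [:: 1; -1; 1; 0]; [:: 1; -1; 0; 1]; [:: 0; 1; -1; 1]].

(* Vectors of positive square ruling out every other list of products. *)
Definition witnesses5 : seq (seq int * seq int) :=
  [:: ([:: -2; -1; 0; 0; -1], [:: 2; 1; 0; 0; 1]);
      ([:: 0; 0; -1; 0; 2], [:: 2; 0; -1; 0; 0]);
      ([:: -2; -1; 0; -2; -2], [:: 2; 1; 0; 0; 0]);
      ([:: -2; -2; -1; -2; 0], [:: 2; 0; 1; 1; 0]);
      ([:: -2; -1; -2; 0; -2], [:: 2; 0; 1; 0; 0]);
      ([:: -2; -2; -2; -1; 0], [:: 2; 1; 0; 0; 0]);
      ([:: -2; 0; -2; -2; -2], [:: 2; 0; 1; 0; 0])].

Lemma products5_complete : let r := [:: -2; -1; 0; 1; 2] in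
  all (fun x1 => all (fun x2 => all (fun x3 => all (fun x4 : int =>
    [|| x1 + x2 + x3 + x4 != 1, [:: x1; x2; x3; x4] \in products5 |
      has (fun t => 0 < orbit_form t.1 t.2 norm5 norm5 [:: -1; x1; x2; x3; x4]) witnesses5])
    r) r) r) r.
Proof. by vm_compute. Qed.

Section Order5.
Variable f : 'M[int]_9.
Hypotheses (hf : isomQ f) (fK : f *m Kcl 8 = Kcl 8) (fp : f ^+ 5 = 1).
Implicit Types (x y a b : 'cV[int]_9).

Definition products x y := [:: dot x y; dot x (f ^+ 1 *m y); dot x (f ^+ 2 *m y);
  dot x (f ^+ 3 *m y); dot x (f ^+ 4 *m y)].

Lemma productsE x y k l : (k < 5)%N -> 
  dot (f ^+ k *m x) (f ^+ l *m y) = (products x y)`_((l + 5 - k) %% 5).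
Proof.
move=> k5; have -> : f ^+ l *m y = f ^+ (l + 5) *m y by rewrite -(pow_mod fp (l + 5)) modnDr pow_mod.
rewrite dot_pow //; last by lia.
rewrite -(pow_mod fp) //; have := ltn_pmod (l + 5 - k) (isT : (0 < 5)%N).
by case: (_ %% 5)%N => [|[|[|[|[|j]]]]] //= _; rewrite expr0 mul1mx.
Qed.

Lemma orthK_le0 x : dot (Kcl 8) x = 0 -> dot x x <= 0 /\ (dot x x = 0 -> x = 0).
Proof.
move=> Kx; have [->|x0] := eqVneq x 0; first by rewrite dot0l.
have := @dot_orth 8 x _ (@fwdK 8 isT) _ x0.
rewrite dotNr dotC Kx oppr0 => /(_ erefl) lt; split; first exact: ltW.
by move=> e; rewrite e ltxx in lt.
Qed.

Lemma orbit_form_le0 c d a b : dot (Kcl 8) a = 0 -> dot (Kcl 8) b = 0 ->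
  orbit_form c d (products a a) (products b b) (products a b) <= 0.
Proof.
move=> Ka Kb; pose u := \sum_(k < 5) c`_k *: (f ^+ k *m a).
pose w := \sum_(k < 5) d`_k *: (f ^+ k *m b).
have K0 e x : dot (Kcl 8) x = 0 -> dot (Kcl 8) (\sum_(k < 5) e`_k *: (f ^+ k *m x)) = 0.
  by move=> Kx; rewrite dot_sumr big1 // => k _; rewrite dotZr dotK_pow // Kx mulr0.
have [le _] : dot (u + w) (u + w) <= 0 /\ _ :=
  orthK_le0 (etrans (dotDr _ _ _) (congr2 +%R (K0 c a Ka) (K0 d b Kb))).
have D x y (s t : seq int) :
  dot (\sum_(k < 5) s`_k *: (f ^+ k *m x)) (\sum_(k < 5) t`_k *: (f ^+ k *m y))
   = \sum_(k < 5) \sum_(l < 5) s`_k * t`_l * (products x y)`_((l + 5 - k) %% 5).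
  rewrite dot_suml; apply: eq_bigr => k _; rewrite dot_sumr; apply: eq_bigr => l _.
  by rewrite dotZl dotZr productsE // mulrA.
suff -> : orbit_form c d (products a a) (products b b) (products a b)
  = dot (u + w) (u + w) by exact: le.
have -> : dot (u + w) (u + w) = dot u u + dot w w + 2 * dot u w.
  by rewrite dotDl !dotDr (dotC w u); ring.
rewrite /u /w !D mulr_sumr -!big_split /=.
have E (F : nat -> int) : sum5 F = \sum_(k < 5) F k by rewrite !big_ord_recr big_ord0 /= add0r.
rewrite /orbit_form E; apply: eq_bigr => k _; rewrite E mulr_sumr -!big_split /=.
by apply: eq_bigr => l _.
Qed.


Hypothesis (hs : orbit_pairing 5 f).

Lemma products_sum x y : dot (Kcl 8) x = 0 -> dot (Kcl 8) y = 0 ->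
  dot x y + dot x (f ^+ 1 *m y) + dot x (f ^+ 2 *m y) + dot x (f ^+ 3 *m y)
    + dot x (f ^+ 4 *m y) = 0.
Proof.
move=> Kx Ky; have := hs y x; rewrite !big_ord_recr big_ord0 /= add0r expr0 mul1mx Kx mulr0 mulr0.
by rewrite mul1r.
Qed.

Lemma norm5P a : dot (Kcl 8) a = 0 -> dot a a = -2 ->
  products a a = norm5 \/ dot a (f ^+ 2 *m a) = 1.
Proof.
move=> Ka aa; have b3 := dot_pow_sym hf fp a a (isT : (3 <= 5)%N).
have b4 := dot_pow_sym hf fp a a (isT : (4 <= 5)%N).
have := products_sum Ka Ka; rewrite /products b3 b4 aa /=.
have test c := orbit_form_le0 c [::] Ka Ka.
(* The first two tests bound b_1 and b_2 by 2. As b_1 + b_2 = 1, only (2, -1) and (-1, 2) need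
   excluding besides (0, 1) and (1, 0); the third and fourth tests do so, with a vector of square 2
   each. *)
move: (test [:: 1; 1]) (test [:: 1; 0; 1]) (test [:: -1; -1; 0; 1; 0]) (test [:: -1; 0; 0; -1; 1]).
rewrite /products b3 b4 aa /=; set b1 := dot a (f ^+ 1 *m a); set b2 := dot a (f ^+ 2 *m a).
rewrite /orbit_form /sum5 /=; move: b1 b2 => b1 b2 t1 t2 t3 t4 sum.
have e1 : b1 = 1 - b2 by lia.
have [e2|e2] : b2 = 0 \/ b2 = 1 by lia.
  by left; rewrite e1 e2.
by right.
Qed.

Lemma products5P a b : dot (Kcl 8) a = 0 -> dot (Kcl 8) b = 0 ->
  products a a = norm5 -> products b b = norm5 -> dot a b = -1 ->
  behead (products a b) \in products5.
Proof.
move=> Ka Kb na nb ab; have sum := products_sum Ka Kb.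
have test c d := orbit_form_le0 c d Ka Kb.
(* The squares of a + f^j b and a - f^j b are at most 0, which leaves finitely many lists. *)
have bnd j : (j < 5)%N -> (products a b)`_j \in [:: -2; -1; 0; 1; 2].
  move=> hj; have t1 := test [:: 1] (mkseq (fun i => (i == j)%:R) 5).
  have t2 := test [:: 1] (mkseq (fun i => - (i == j)%:R) 5).
  move: t1 t2; rewrite na nb /orbit_form /sum5.
  by case: j hj => [|[|[|[|[|j]]]]] //= _; rewrite !inE; lia.
have h1 : dot a (f ^+ 1 *m b) \in [:: -2; -1; 0; 1; 2] := bnd 1%N isT.
have h2 : dot a (f ^+ 2 *m b) \in [:: -2; -1; 0; 1; 2] := bnd 2%N isT.
have h3 : dot a (f ^+ 3 *m b) \in [:: -2; -1; 0; 1; 2] := bnd 3%N isT.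
have h4 : dot a (f ^+ 4 *m b) \in [:: -2; -1; 0; 1; 2] := bnd 4%N isT.
have test' t := test t.1 t.2; rewrite na nb /products ab in test'.
rewrite ab in sum; rewrite /products [behead _]/=.
move: sum test' h1 h2 h3 h4.
move: (dot a _) (dot a _) (dot a _) (dot a _) => x1 x2 x3 x4 sum test' h1 h2 h3 h4.
have := products5_complete; cbv zeta.
move=> /allP/(_ _ h1)/allP/(_ _ h2)/allP/(_ _ h3)/allP/(_ _ h4).
case/or3P => [/eqP|//|/hasP[t _]]; first by lia.
by rewrite ltNge test'.
Qed.

(** Replacing [b] by s f^m b with s = 1 or -1 keeps the products within its orbit, and shifts and
    signs the list of products with [a]. *)
Lemma pair_coxeter_conj5 a b (k : nat) W R arc m s : coxeter_check 8 k 5 W R (pattern 5 norm5 arc) 0 ->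
  size W = 2%N -> dot (Kcl 8) a = 0 -> dot (Kcl 8) b = 0 ->
  products a a = norm5 -> products b b = norm5 -> s * s = 1 -> (m < 5)%N ->
  all (fun d => s * (products a b)`_((d + m) %% 5) == arc`_d) (iota 0 5) -> coxeter_conj f.
Proof.
move=> hc sW Ka Kb na nb ss m5 harc; pose b' := s *: (f ^+ m *m b).
have dE x y d : (d < 5)%N -> dot x (f ^+ d *m y) = (products x y)`_d.
  by case: d => [|[|[|[|[|d]]]]] //= _; rewrite expr0 mul1mx.
have Kb' : dot (Kcl 8) b' = 0 by rewrite dotZr dotK_pow // Kb mulr0.
apply: (@coxeter_chain 8 k 5 W R _ _ _ f [:: a; b'] isT isT hc hf fK fp (esym sW)).
- by move=> x; rewrite !inE => /orP[] /eqP->.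
- move=> x; rewrite !inE => /orP[] /eqP-> d hd; first by rewrite dE // na.
  rewrite /b' -scalemxAr dotZl dotZr mulrA ss mul1r.
  rewrite mulmxA -[f ^+ d *m _]/(f ^+ d * _) -exprD addnC exprD -[f ^+ m * _]/(_ *m _) -mulmxA.
  by rewrite isom_dot ?dE ?nb //; apply: isomX.
apply/andP; split=> //; apply/andP; split=> //; apply/allP => d hd.
rewrite /b' -scalemxAr dotZr mulmxA -[f ^+ d *m _]/(f ^+ d * _) -exprD -(pow_mod fp).
rewrite dE ?ltn_mod //; exact: (allP harc d hd).
Qed.

(** Fix one root [a]. Only - f a and - f^4 a can produce one of the first two lists of [products5],
    so one of the three other roots gives a list covered by [check8A] or [check8C]. *)
Lemma four_roots_coxeter_conj5 (l : seq 'cV[int]_9) : uniq l -> (3 < size l)%N ->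
  {in l, forall a, dot (Kcl 8) a = 0 /\ products a a = norm5} ->
  {in l &, forall a b, a != b -> dot a b = -1} -> coxeter_conj f.
Proof.
case: l => // a l /= /andP[al ul] sl hl hab.
have [Ka na] := hl a (mem_head _ _).
have hb b : b \in l -> [/\ dot (Kcl 8) b = 0, products b b = norm5 & dot a b = -1].
  move=> bl; have [Kb nb] : dot (Kcl 8) b = 0 /\ products b b = norm5.
    by apply: hl; rewrite inE bl orbT.
  split=> //; apply: hab; rewrite ?inE ?eqxx ?bl ?orbT //.
  by apply: contraNneq al => ->.
have opp j b : b \in l -> (0 < j < 5)%N -> dot a (f ^+ j *m b) = 2 -> b = - (f ^+ (5 - j) *m a).
  move=> bl /andP[j0 j5] e; have [Kb nb ab] := hb b bl.
  have aa : dot a a = -2 by case: na.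
  have bb : dot b b = -2 by case: nb.
  have Kw : dot (Kcl 8) (a + f ^+ j *m b) = 0 by rewrite dotDr dotK_pow // Ka Kb addr0.
  have [_ w0] := orthK_le0 Kw.
  have /w0/eqP : dot (a + f ^+ j *m b) (a + f ^+ j *m b) = 0.
    by rewrite dotDl !dotDr (dotC _ a) e aa isom_dot ?bb //; exact: isomX.
  rewrite addrC addr_eq0 => /eqP fb.
  rewrite -mulmxN -fb mulmxA -[f ^+ _ *m f ^+ j]/(f ^+ _ * f ^+ j) -exprD subnK ?(ltnW j5) //.
  by rewrite fp mul1mx.
have [/hasP[b bl hX]|no] :=
  boolP (has (fun b => (dot a (f ^+ 1 *m b) != 2) && (dot a (f ^+ 4 *m b) != 2)) l).
  have [Kb nb ab] := hb b bl; have := products5P Ka Kb na nb ab.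
  have X0 : products a b = -1 :: behead (products a b) by rewrite /products ab.
  have A m s := @pair_coxeter_conj5 a b 6 frame8A dual8A _ m s check8A erefl Ka Kb na nb.
  have C m s := @pair_coxeter_conj5 a b 6 frame8C dual8C _ m s check8C erefl Ka Kb na nb.
  rewrite !inE => /or4P[/eqP e|/eqP e|/eqP e|/or4P[/eqP e|/eqP e|/eqP e|/orP[]/eqP e]].
  - by move: hX; case: e => ->; rewrite eqxx.
  - by move: hX; case: e => _ _ _ ->; rewrite eqxx andbF.
  - by apply: (A 0%N 1) => //; rewrite X0 e.
  - by apply: (A 4%N (-1)) => //; rewrite X0 e.
  - by apply: (C 3%N 1) => //; rewrite X0 e.
  - by apply: (C 0%N 1) => //; rewrite X0 e.
  - by apply: (C 4%N (-1)) => //; rewrite X0 e.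
  by apply: (C 2%N (-1)) => //; rewrite X0 e.
have : (size l <= size [:: - (f ^+ 4 *m a); - (f ^+ 1 *m a)])%N.
  apply: uniq_leq_size => // b bl; rewrite !inE.
  have /hasPn/(_ b bl) := no; rewrite negb_and !negbK => /orP[/eqP e|/eqP e].
    by rewrite {1}(opp 1%N b bl isT e) eqxx.
  by rewrite {2}(opp 4%N b bl isT e) eqxx orbT.
by rewrite leqNgt -ltnS sl.
Qed.

End Order5.

(** The E_i + K are eight roots with pairwise products -1. By [norm5P] each has products [norm5] for
    [f] or for f^2, so at least four of them do for the same one of the two. *)
Lemma coxeter_conj_n8_p5 (f : 'M[int]_9) : isomQ f -> f *m Kcl 8 = Kcl 8 -> f ^+ 5 = 1 ->
  orbit_pairing 5 f -> coxeter_conj f.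
Proof.
move=> hf fK fp hs; pose S := [seq x + Kcl 8 | x <- exceptionals 8].
have hS : {in S, forall a, dot (Kcl 8) a = 0 /\ dot a a = -2}.
  move=> a /mapP[x /exceptionalP[xx Kx] ->]; have KK : dot (Kcl 8) (Kcl 8) = 1 by rewrite dotKK.
  by rewrite (dotDr _ x) dotDl (dotDr x x) (dotDr _ x) (dotC x (Kcl 8)) Kx xx KK.
have hSS : {in S &, forall a b, a != b -> dot a b = -1}.
  move=> a b /mapP[x hx ->] /mapP[y hy ->] xy.
  have [_ Kx] := exceptionalP hx; have [_ Ky] := exceptionalP hy.
  have KK : dot (Kcl 8) (Kcl 8) = 1 by rewrite dotKK.
  rewrite dotDl (dotDr x y) (dotDr _ y) (dotC x (Kcl 8)) Kx Ky KK (@exceptional_orth 8 isT x y) //.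
  by apply: contraNneq xy => ->.
have uS : uniq S.
  by rewrite map_inj_uniq ?(@exceptionals_uniq 8 isT) //; apply: addIr.
pose q := fun a : 'cV[int]_9 => products f a a == norm5.
have sS : (size (filter q S) + size (filter (predC q) S) = 8)%N.
  by rewrite !size_filter count_predC size_map size_exceptionals.
have [s1|s1] := ltnP 3 (size (filter q S)).
  apply: (four_roots_coxeter_conj5 hf fK fp hs (filter_uniq q uS) s1) => [a|a b].
    by rewrite mem_filter => /andP[/eqP na /hS[]].
  by rewrite !mem_filter => /andP[_ aS] /andP[_ bS]; apply: hSS.
pose g := f ^+ 2.
have hg : isomQ g by exact: isomX.
have gK : g *m Kcl 8 = Kcl 8 by exact: expfix.
have gp : g ^+ 5 = 1 by rewrite -exprM mulnC exprM fp expr1n.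
have gs : orbit_pairing 5 g.
  move=> x y; have := hs x y; rewrite !big_ord_recr !big_ord0 /= -!exprM.
  by rewrite -(pow_mod fp (2 * 3)) -(pow_mod fp (2 * 4)) => <-; congr (_ * _); rewrite !add0r; ring.
apply: (@coxeter_conj_pow 8 5 2 f 3 fp) => //.
apply: (four_roots_coxeter_conj5 hg gK gp gs (filter_uniq (predC q) uS)) => [|a|a b].
- by move: sS s1; case: (size _) => [|[|[|[|k]]]] //=; lia.
- rewrite mem_filter => /andP[/eqP nq /hS[Ka aa]]; split=> //.
  have [//|b2] := norm5P hf fK fp hs Ka aa.
  have b4 : dot a (f ^+ 4 *m a) = 0.
    have e3 : dot a (f ^+ 3 *m a) = dot a (f ^+ 2 *m a) := dot_pow_sym hf fp a a (isT : (3 <= 5)%N).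
    have e4 : dot a (f ^+ 4 *m a) = dot a (f ^+ 1 *m a) := dot_pow_sym hf fp a a (isT : (4 <= 5)%N).
    by have := products_sum hs Ka Ka; rewrite e3 aa b2 -e4; lia.
  rewrite /products aa -!exprM /norm5; congr [:: _; _; _; _; _] => //.
  - by rewrite -(pow_mod fp) /= -[in RHS]b4 (dot_pow_sym hf fp (d := 4)).
  by rewrite -(pow_mod fp) /= (dot_pow_sym hf fp (d := 3)).
by rewrite !mem_filter => /andP[_ aS] /andP[_ bS]; apply: hSS.
Qed.

(** * Irreducible classes of odd prime order fixing K *)

Section Final.
Variables (R : realType) (n p : nat) (f : 'M[int]_n.+1).
Hypotheses (hn : (3 <= n <= 8)%N) (pp : prime p) (podd : odd p).
Hypotheses (fp : f ^+ p = 1) (hf : isomQ f) (fK : f *m Kcl n = Kcl n) (irr : irreducible f).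

Lemma irreducible_pairing : orbit_pairing p f.
Proof.
move=> x y; have := irreducible_orbit_sum R hn x podd fp hf fK irr.
move/(congr1 (Defs.form (QM n) y)); rewrite !dotZr /orbit_sum dot_sumr => ->.
by rewrite (dotC y) mulrA.
Qed.

Lemma irreducible_cases :
  [\/ n = 4%N /\ p = 5%N, n = 6%N /\ p = 3%N, n = 8%N /\ p = 3%N | n = 8%N /\ p = 5%N].
Proof.
have dv := irreducible_degree R hn podd fp hf fK irr.
have [n8|n8] := eqVneq n 8%N.
  have [->|->] : p = 3%N \/ p = 5%N; [|by apply: Or43|by apply: Or44].
  move: f fp hf fK irr; rewrite n8 => g gp hg gK girr.
  exact: (irreducible_order8 R pp podd gp hg gK girr).
have n9 : (9 - n)%N != 1%N by move: hn n8; lia.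
have e : (9 - n)%N = p by apply/(prime_nt_dvdP pp n9).
have [p3|p5] : p = 3%N \/ p = 5%N by move: hn n8 podd e; clear; lia.
  by apply: Or42; move: hn e; lia.
by apply: Or41; move: hn e; lia.
Qed.

Lemma irreducible_coxeter_conj : coxeter_conj f.
Proof.
have hs := irreducible_pairing.
case: irreducible_cases => -[en ep]; move: f fp hf fK hs; rewrite en ep => g gp hg gK gs.
- exact: coxeter_conj_n4_p5.
- exact: coxeter_conj_n6_p3.
- exact: coxeter_conj_n8_p3.
exact: coxeter_conj_n8_p5.
Qed.

End Final.

Theorem theorem1p5 (R : realType) (n : nat) (hn : (3 <= n <= 8)%N)
    (f : 'M[int]_n.+1) (hf : ModPlus R f) (hirr : irreducible f)
    (p : nat) (hp : prime p) (hodd : odd p) (hord : has_order f p) :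
  exists (c h : 'M[int]_n.+1) (k : int),
    [/\ coxeter_element c, ModPlus R h & f = h * c ^ k * h^-1].
Proof.
have [p0 fp _] := hord.
have [g hg f'K] := irreducible_conj hn hf hirr p0 fp.
have ig := ModPlus_isom hg; have if_ := ModPlus_isom hf.
set f' := g *m f *m adj g in f'K.
have if' : isomQ f' by apply: isomM; [exact: isomM | exact: isom_adj].
have f'p : f' ^+ p = 1 by rewrite conjX // fp mulmx1 adjr.
have irr' : irreducible f' by move/(reducible_conj ig).
have [h [k [ih hK fh]]] := irreducible_coxeter_conj R hn hp hodd f'p if' f'K irr'.
have hh : ModPlus R h by apply: (isom_fwd R ih (fwdK hn)); rewrite mulmxN hK.
have hH : ModPlus R (adj g *m h) by apply: ModPlusM => //; exact: ModPlus_adj.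
exists (coxeter n), (adj g *m h), k%:Z; split=> //; first by exists (simple_roots n).
have uH := isom_unit (ModPlus_isom hH).
apply: (mulIr uH); rewrite divrK //.
have -> : f * (adj g *m h) = adj g *m (f' *m h).
  by rewrite /f' -(mulmxA (g *m f)) -(mulmxA g) (mulmxA (adj g)) adjl // mul1mx.
by rewrite fh mulmxA.
Qed.
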